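(* Let $1 \leq k \leq n$ be integers. As graded $\mathfrak{S}_n$-modules, \[ S_{n,k} \cong R_{n,n}\langle 0 \rangle \oplus R_{n,n-1}\langle -1 \rangle \oplus \cdots \oplus R_{n,k}\langle -n+k \rangle . \]
   Context: The symmetric group $\mathfrak{S}_n$ acts on $\mathbb{Q}[x_1,\dots,x_n]$ by variable permutation, $w \cdot x_i = x_{w(i)}$. Let $e_d = e_d(x_1,\dots,x_n)$ be the degree $d$ elementary symmetric polynomial and let $e_d^{(i)} = e_d(x_1,\dots,x_{i-1},x_{i+1},\dots,x_n)$ be the one with the variable $x_i$ omitted. Conventions: the degree $0$ elementary symmetric polynomial is $1$, and $e_d = e_d^{(i)} = 0$ for $d<0$. Define the ideals \[ J_n = \langle x_i^d \cdot e_{n-r}^{(i)} : 1 \leq i \leq n,\ 1 \leq r \leq d \rangle, \qquad J_{n,k} = J_n + \langle e_n, e_{n-1}, \ldots, e_{n-k+1}\rangle \] of $\mathbb{Q}[x_1,\dots,x_n]$ (here $d$ ranges over positive integers), and $S_{n,k} = \mathbb{Q}[x_1,\dots,x_n]/J_{n,k}$. For $1 \leq j \leq n$ define \[ I_{n,j} = \langle x_1^j, x_2^j, \ldots, x_n^j, e_n, e_{n-1}, \ldots, e_{n-j+1}\rangle, \qquad R_{n,j} = \mathbb{Q}[x_1,\dots,x_n]/I_{n,j}. \] All these quotients are graded $\mathfrak{S}_n$-modules by polynomial degree. For a graded module $M$ and $a \in \mathbb{Z}$, $M\langle a \rangle$ denotes the graded module whose degree $d$ component is $M_{d+a}$; thus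 $M\langle -m\rangle$ is $M$ with all degrees raised by $m$. *)

(* Defs.v *)
From HB Require Import structures.
From mathcomp Require Import all_boot all_order all_algebra all_fingroup.
From mathcomp Require Import boolp mpoly.

Set Implicit Arguments.
Unset Strict Implicit.
Unset Printing Implicit Defensive.

Import GRing.Theory.
Local Open Scope ring_scope.

(* Z-graded rational representations of the symmetric group.                 *)
(* The module is the internal direct sum of its components [grcomp d]:       *)
(* [grcomp_span] says that they span it, [grcomp_indep] that they are        *)
(* independent.  In mathcomp [(v * w)%g i = w (v i)], so [gractM] makes      *)
(* [gract] a left action for the usual composition of permutations.          *)
Record gradedSnModule (n : nat) := GradedSnModule {
  grcarrier :> lmodType rat;
  grcomp : int -> grcarrier -> Prop;
  gract : 'S_n -> grcarrier -> grcarrier;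
  grcomp0 : forall d, grcomp d 0;
  grcompP : forall d a x y, grcomp d x -> grcomp d y -> grcomp d (a *: x + y);
  grcomp_span : forall x, exists (s : seq int) (f : int -> grcarrier),
    [/\ uniq s, forall d, grcomp d (f d) & x = \sum_(d <- s) f d];
  grcomp_indep : forall (s : seq int) (f : int -> grcarrier),
    uniq s -> (forall d, grcomp d (f d)) -> \sum_(d <- s) f d = 0 ->
    forall d, d \in s -> f d = 0;
  gract_linear : forall w, linear (gract w);
  gract1 : forall x, gract 1%g x = x;
  gractM : forall v w x, gract (v * w)%g x = gract w (gract v x);
  grcomp_act : forall d w x, grcomp d x -> grcomp d (gract w x)
}.

Definition graded_iso (n : nat) (M N : gradedSnModule n) : Prop :=
  exists f : {linear M -> N},
    [/\ bijective f,
        forall w x, f (gract w x) = gract w (f x)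
      & forall d x, grcomp d (f x) <-> grcomp d x].

Section Shift.
Variables (n : nat) (M : gradedSnModule n) (a : int).

Let shcomp (d : int) (x : M) : Prop := grcomp (d + a) x.

Lemma gshift_span (x : M) : exists (s : seq int) (f : int -> M),
  [/\ uniq s, forall d, shcomp d (f d) & x = \sum_(d <- s) f d].
Proof.
have [s [f [us fP ->]]] := grcomp_span x.
exists [seq d - a | d <- s], (fun d => f (d + a)); split.
- by rewrite map_inj_uniq //; apply: addIr.
- by move=> d; apply: fP.
- by rewrite big_map; apply: eq_bigr => d _; rewrite subrK.
Qed.

Lemma gshift_indep (s : seq int) (f : int -> M) :
  uniq s -> (forall d, shcomp d (f d)) -> \sum_(d <- s) f d = 0 ->
  forall d, d \in s -> f d = 0.
Proof.
move=> us fP f0 d ds.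
have := @grcomp_indep n M [seq e + a | e <- s] (fun e => f (e - a)).
rewrite map_inj_uniq; last exact: addIr.
move=> /(_ us) H; have: f (d + a - a) = 0; last by rewrite addrK.
apply: H; last exact: (map_f (fun e => e + a)).
- by move=> e; have := fP (e - a); rewrite /shcomp subrK.
- by rewrite big_map -[RHS]f0; apply: eq_bigr => e _; rewrite addrK.
Qed.

Definition gshift : gradedSnModule n :=
  @GradedSnModule n M shcomp (@gract n M)
    (fun d => grcomp0 M (d + a)) (fun d => @grcompP n M (d + a))
    gshift_span gshift_indep (@gract_linear n M) (@gract1 n M) (@gractM n M)
    (fun d => @grcomp_act n M (d + a)).

End Shift.

Definition lmod_prod (I : finType) (M : I -> lmodType rat) : Type :=
  forall i, M i.

Section DProdLmodule.
Variables (I : finType) (M : I -> lmodType rat).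
Implicit Types x y z : lmod_prod M.

HB.instance Definition _ := Choice.copy (lmod_prod M) (forall i, M i).

Let dadd x y : lmod_prod M := fun i => x i + y i.
Let dopp x : lmod_prod M := fun i => - x i.
Let dscale (a : rat) x : lmod_prod M := fun i => a *: x i.

Let daddA : associative dadd.
Proof. by move=> x y z; apply: functional_extensionality_dep => i; exact: addrA. Qed.
Let daddC : commutative dadd.
Proof. by move=> x y; apply: functional_extensionality_dep => i; exact: addrC. Qed.
Let dadd0 : left_id (fun i => 0 : M i) dadd.
Proof. by move=> x; apply: functional_extensionality_dep => i; exact: add0r. Qed.
Let daddN : left_inverse (fun i => 0 : M i) dopp dadd.
Proof. by move=> x; apply: functional_extensionality_dep => i; exact: addNr. Qed.

HB.instance Definition _ :=
  GRing.isZmodule.Build (lmod_prod M) daddA daddC dadd0 daddN.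

Let dscaleA a b x : dscale a (dscale b x) = dscale (a * b) x.
Proof. by apply: functional_extensionality_dep => i; exact: scalerA. Qed.
Let dscale1 : left_id 1 dscale.
Proof. by move=> x; apply: functional_extensionality_dep => i; exact: scale1r. Qed.
Let dscaleDr : right_distributive dscale +%R.
Proof. by move=> a x y; apply: functional_extensionality_dep => i; exact: scalerDr. Qed.
Let dscaleDl x : {morph dscale^~ x : a b / a + b}.
Proof. by move=> a b; apply: functional_extensionality_dep => i; exact: scalerDl. Qed.

HB.instance Definition _ :=
  GRing.Zmodule_isLmodule.Build rat (lmod_prod M) dscaleA dscale1 dscaleDr dscaleDl.

Lemma lmod_prod_sumE (J : Type) (s : seq J) (F : J -> lmod_prod M) i :
  (\sum_(j <- s) F j) i = \sum_(j <- s) F j i.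
Proof. by elim: s => [|j s IHs]; rewrite ?big_nil ?big_cons // -IHs. Qed.

End DProdLmodule.

Section DirectSum.
Variables (n : nat) (I : finType) (M : I -> gradedSnModule n).

Let C : lmodType rat := lmod_prod (fun i => grcarrier (M i)).
Let dcomp (d : int) (x : C) : Prop := forall i, grcomp d (x i).
Let dact (w : 'S_n) (x : C) : C := fun i => gract w (x i).

Lemma gdsum_comp0 d : dcomp d 0.
Proof. by move=> i; apply: grcomp0. Qed.

Lemma gdsum_compP d a x y : dcomp d x -> dcomp d y -> dcomp d (a *: x + y).
Proof. by move=> dx dy i; apply: grcompP. Qed.

Lemma gdsum_span x : exists (s : seq int) (f : int -> C),
  [/\ uniq s, forall d, dcomp d (f d) & x = \sum_(d <- s) f d].
Proof.
pose sf i := cid (grcomp_span (x i)); pose s i := sval (sf i).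
pose f i := sval (cid (svalP (sf i))).
have fP i : [/\ uniq (s i), forall d, grcomp d (f i d)
               & x i = \sum_(d <- s i) f i d] by exact: (svalP (cid (svalP (sf i)))).
exists (undup (flatten [seq s i | i <- enum I])).
exists (fun d i => if d \in s i then f i d else 0); split.
- exact: undup_uniq.
- by move=> d i; case: ifP => _; [have [_ H _] := fP i; apply: H | apply: grcomp0].
- apply: functional_extensionality_dep => i; rewrite lmod_prod_sumE.
  have [us _ ->] := fP i; rewrite -big_mkcond -big_filter.
  apply: perm_big; apply: uniq_perm => //; first exact/filter_uniq/undup_uniq.
  move=> d; rewrite mem_filter mem_undup; case: (boolP (d \in s i)) => //= ds.
  by apply/esym/flattenP; exists (s i) => //; apply: map_f; rewrite mem_enum.
Qed.

Lemma gdsum_indep (s : seq int) (f : int -> C) :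
  uniq s -> (forall d, dcomp d (f d)) -> \sum_(d <- s) f d = 0 ->
  forall d, d \in s -> f d = 0.
Proof.
move=> us fP f0 d ds; apply: functional_extensionality_dep => i.
apply: (@grcomp_indep n (M i) s (fun e => f e i)) => //.
- by move=> e; apply: fP.
- by rewrite -lmod_prod_sumE f0.
Qed.

Lemma gdsum_act_linear w : linear (dact w).
Proof.
by move=> a x y; apply: functional_extensionality_dep => i; apply: gract_linear.
Qed.

Lemma gdsum_act1 x : dact 1%g x = x.
Proof. by apply: functional_extensionality_dep => i; apply: gract1. Qed.

Lemma gdsum_actM v w x : dact (v * w)%g x = dact w (dact v x).
Proof. by apply: functional_extensionality_dep => i; apply: gractM. Qed.

Lemma gdsum_comp_act d w x : dcomp d x -> dcomp d (dact w x).
Proof. by move=> dx i; apply: grcomp_act. Qed.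

Definition gdsum : gradedSnModule n :=
  GradedSnModule gdsum_comp0 gdsum_compP gdsum_span gdsum_indep
    gdsum_act_linear gdsum_act1 gdsum_actM gdsum_comp_act.

End DirectSum.

Section IdealQuotient.
Variables (n : nat) (G : {mpoly rat[n]} -> Prop).
Local Notation P := {mpoly rat[n]}.

Definition ideal_gen : {pred P} := fun p =>
  `[< exists s : seq (P * P),
        (forall c, c \in s -> G c.2) /\ p = \sum_(c <- s) c.1 * c.2 >].

Lemma ideal_genM q g : G g -> q * g \in ideal_gen.
Proof.
move=> Gg; apply/asboolP; exists [:: (q, g)]; rewrite big_seq1; split=> // c.
by rewrite inE => /eqP->.
Qed.

Lemma ideal_genD : {in ideal_gen &, forall p q, p + q \in ideal_gen}.
Proof.
move=> p q /asboolP[s [sG ->]] /asboolP[t [tG ->]]; apply/asboolP.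
exists (s ++ t); rewrite big_cat; split=> // c.
by rewrite mem_cat => /orP[/sG|/tG].
Qed.

Lemma ideal_genMl q p : p \in ideal_gen -> q * p \in ideal_gen.
Proof.
move=> /asboolP[s [sG ->]]; apply/asboolP.
exists [seq (q * c.1, c.2) | c <- s]; split.
  by move=> c /mapP[c' /sG c'G ->].
by rewrite big_map mulr_sumr; apply: eq_bigr => c _; rewrite mulrA.
Qed.

Lemma ideal_gen0 : 0 \in ideal_gen.
Proof. by apply/asboolP; exists [::]; rewrite big_nil. Qed.

Lemma ideal_gen_zmod : zmod_closed ideal_gen.
Proof.
split=> [|p q pI qI]; first exact: ideal_gen0.
by apply: ideal_genD => //; rewrite -mulN1r; apply: ideal_genMl.
Qed.

HB.instance Definition _ := GRing.isZmodClosed.Build P ideal_gen ideal_gen_zmod.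

Lemma ideal_genZ a p : p \in ideal_gen -> a *: p \in ideal_gen.
Proof. by rewrite -mul_mpolyC; apply: ideal_genMl. Qed.

Definition mpoly_quot : Type := {ideal_quot ideal_gen}.
HB.instance Definition _ := GRing.Zmodule.on mpoly_quot.

Definition mpoly_pi (p : P) : mpoly_quot := \pi_({ideal_quot ideal_gen})%qT p.

Lemma mpoly_pi_eq p q : (mpoly_pi p = mpoly_pi q) <-> p - q \in ideal_gen.
Proof. by rewrite Quotient.idealrBE; split => /eqP. Qed.

Lemma mpoly_pi_surj x : exists p, x = mpoly_pi p.
Proof. by exists (generic_quotient.repr (x : {ideal_quot ideal_gen})); rewrite /mpoly_pi reprK. Qed.

Lemma mpoly_piD p q : mpoly_pi (p + q) = mpoly_pi p + mpoly_pi q.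
Proof. exact: (@Quotient.pi_add _ ideal_gen p q). Qed.

Lemma mpoly_pi0 : mpoly_pi 0 = 0.
Proof. by apply: (addrI (mpoly_pi 0)); rewrite -mpoly_piD !addr0. Qed.

Lemma mpoly_pi_sum J (s : seq J) (F : J -> P) :
  mpoly_pi (\sum_(j <- s) F j) = \sum_(j <- s) mpoly_pi (F j).
Proof.
by elim: s => [|j s IHs]; rewrite ?big_nil ?mpoly_pi0 // !big_cons mpoly_piD IHs.
Qed.

Definition mpoly_quot_scale (a : rat) (x : mpoly_quot) : mpoly_quot :=
  mpoly_pi (a *: generic_quotient.repr (x : {ideal_quot ideal_gen})).

Lemma mpoly_pi_repr p : generic_quotient.repr (mpoly_pi p : {ideal_quot ideal_gen}) - p \in ideal_gen.
Proof. by apply/mpoly_pi_eq; rewrite /mpoly_pi reprK. Qed.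

Lemma mpoly_quot_scaleE a p : mpoly_quot_scale a (mpoly_pi p) = mpoly_pi (a *: p).
Proof.
by apply/mpoly_pi_eq; rewrite -scalerBr; apply/ideal_genZ/mpoly_pi_repr.
Qed.

Let scaleA a b x :
  mpoly_quot_scale a (mpoly_quot_scale b x) = mpoly_quot_scale (a * b) x.
Proof. by have [p ->] := mpoly_pi_surj x; rewrite !mpoly_quot_scaleE scalerA. Qed.
Let scale1 : left_id 1 mpoly_quot_scale.
Proof. by move=> x; have [p ->] := mpoly_pi_surj x; rewrite mpoly_quot_scaleE scale1r. Qed.
Let scaleDr : right_distributive mpoly_quot_scale +%R.
Proof.
move=> a x y; have [p ->] := mpoly_pi_surj x; have [q ->] := mpoly_pi_surj y.
by rewrite -mpoly_piD !mpoly_quot_scaleE -mpoly_piD scalerDr.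
Qed.
Let scaleDl x : {morph mpoly_quot_scale^~ x : a b / a + b}.
Proof.
move=> a b /=; have [p ->] := mpoly_pi_surj x.
by rewrite !mpoly_quot_scaleE -mpoly_piD scalerDl.
Qed.

HB.instance Definition _ :=
  GRing.Zmodule_isLmodule.Build rat mpoly_quot scaleA scale1 scaleDr scaleDl.

Lemma mpoly_piZ a p : mpoly_pi (a *: p) = a *: mpoly_pi p.
Proof. by rewrite -mpoly_quot_scaleE. Qed.

Hypothesis G_homog : forall g, G g -> exists d, g \is d.-homog.
Hypothesis G_stable : forall w g, G g -> G (msym w g).

Lemma ideal_gen_pihomog d p : p \in ideal_gen -> pihomog mdeg d p \in ideal_gen.
Proof.
move=> /asboolP[s [sG ->]]; rewrite linear_sum /=.
rewrite big_seq; apply: rpred_sum => -[q g] /sG /= Gg.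
have [e ge] := G_homog Gg.
rewrite [q]mpolyE mulr_suml linear_sum /=; apply: rpred_sum => m _.
have hm : (q@_m *: 'X_[m]) * g \is (mdeg m + e).-homog.
  by apply: dhomogM => //; apply: dhomogZ; rewrite dhomogX.
have [<-|ne] := eqVneq (mdeg m + e)%N d.
  by rewrite pihomog_dE //; apply: ideal_genM.
by rewrite (pihomog_ne0 ne hm) ideal_gen0.
Qed.

Lemma ideal_gen_msym w p : p \in ideal_gen -> msym w p \in ideal_gen.
Proof.
move=> /asboolP[s [sG ->]]; rewrite linear_sum /=.
rewrite big_seq; apply: rpred_sum => -[q g] /sG /= Gg.
by rewrite msymM; apply/ideal_genM/G_stable.
Qed.

(* The components of a quotient are the images of the homogeneous            *)
(* polynomials of each degree; there is nothing in negative degree.          *)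
Definition quot_comp (d : int) (x : mpoly_quot) : Prop :=
  if d is Posz d' then exists2 p, p \is d'.-homog & x = mpoly_pi p else x = 0.

(* Well defined on classes by [quot_actE]; [msym w] maps 'X_i to 'X_(w i),   *)
(* see [msym_X].                                                             *)
Definition quot_act (w : 'S_n) (x : mpoly_quot) : mpoly_quot :=
  mpoly_pi (msym w (generic_quotient.repr (x : {ideal_quot ideal_gen}))).

Lemma quot_actE w p : quot_act w (mpoly_pi p) = mpoly_pi (msym w p).
Proof.
by apply/mpoly_pi_eq; rewrite -msymB; apply/ideal_gen_msym/mpoly_pi_repr.
Qed.

Lemma quot_comp0 d : quot_comp d 0.
Proof. by case: d => d //=; exists 0; rewrite ?mpoly_pi0 ?dhomog0. Qed.

Lemma quot_compP d a x y :
  quot_comp d x -> quot_comp d y -> quot_comp d (a *: x + y).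
Proof.
case: d => d /=; last by move=> -> ->; rewrite scaler0 addr0.
move=> [p hp ->] [q hq ->]; exists (a *: p + q).
  by apply: dhomogD => //; apply: dhomogZ.
by rewrite mpoly_piD mpoly_piZ.
Qed.

Lemma quot_span x : exists (s : seq int) (f : int -> mpoly_quot),
  [/\ uniq s, forall d, quot_comp d (f d) & x = \sum_(d <- s) f d].
Proof.
have [p ->] := mpoly_pi_surj x; set k := mmeasure mdeg p.
exists [seq Posz (d : nat) | d <- iota 0 k].
exists (fun d => if d is Posz d' then mpoly_pi (pihomog mdeg d' p) else 0).
split.
- by rewrite map_inj_uniq ?iota_uniq // => d e [].
- by case=> d //=; exists (pihomog mdeg d p); first exact: pihomogP.
- rewrite big_map [in LHS](pihomog_partitionE (leqnn k)) -mpoly_pi_sum.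
  by rewrite -(big_mkord xpredT (fun d => pihomog mdeg d p)) /index_iota subn0.
Qed.

Lemma quot_indep (s : seq int) (f : int -> mpoly_quot) :
  uniq s -> (forall d, quot_comp d (f d)) -> \sum_(d <- s) f d = 0 ->
  forall d, d \in s -> f d = 0.
Proof.
move=> us fP f0 d ds.
have /choice[g gP] : forall e : int, exists p, mpoly_pi p = f e /\
    (if e is Posz e' then p \is e'.-homog else p == 0 : bool).
  case=> e; first by have [p hp ->] := fP e%:Z; exists p.
  by exists 0; rewrite (fP (Negz e)) mpoly_pi0.
case: d ds => d ds; last exact: (fP (Negz d)).
rewrite -[f _](gP _).1 -mpoly_pi0; apply/mpoly_pi_eq; rewrite subr0.
have gI : \sum_(e <- s) g e \in ideal_gen.
  rewrite -[X in X \in _]subr0; apply/mpoly_pi_eq; rewrite mpoly_pi_sum mpoly_pi0.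
  by rewrite -[RHS]f0; apply: eq_bigr => e _; case: (gP e).
move/(ideal_gen_pihomog d): gI; rewrite linear_sum (bigD1_seq d%:Z) //=.
rewrite pihomog_dE; last by case: (gP d%:Z).
rewrite big1 ?addr0 // => e; have [_] := gP e; case: e => e.
  by move=> he ne; apply: pihomog_ne0 he.
by move=> /eqP-> _; rewrite linear0.
Qed.

Lemma quot_act_linear w : linear (quot_act w).
Proof.
move=> a x y; have [p ->] := mpoly_pi_surj x; have [q ->] := mpoly_pi_surj y.
by rewrite -mpoly_piZ -mpoly_piD !quot_actE -mpoly_piZ -mpoly_piD linearP.
Qed.

Lemma quot_act1 x : quot_act 1%g x = x.
Proof. by have [p ->] := mpoly_pi_surj x; rewrite quot_actE msym1m. Qed.

Lemma quot_actM v w x : quot_act (v * w)%g x = quot_act w (quot_act v x).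
Proof. by have [p ->] := mpoly_pi_surj x; rewrite !quot_actE msymMm. Qed.

Lemma msym_dhomog w d (p : P) : p \is d.-homog -> msym w p \is d.-homog.
Proof.
move=> hp; rewrite [p]mpolyE linear_sum /= big_seq; apply: rpred_sum => m mp.
rewrite linearZ /= msymX; apply: dhomogZ; rewrite dhomogX -(dhomog_mf hp mp).
apply/eqP; rewrite /= (mdegE m) mdegE [RHS](reindex_inj (@perm_inj _ w^-1%g)).
by apply: eq_bigr => i _; rewrite mnmE.
Qed.

Lemma quot_comp_act d w x : quot_comp d x -> quot_comp d (quot_act w x).
Proof.
case: d => d /=; last by move=> ->; rewrite -mpoly_pi0 quot_actE msym0.
by move=> [p hp ->]; rewrite quot_actE; exists (msym w p); first exact: msym_dhomog.
Qed.

Definition graded_quot : gradedSnModule n :=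
  GradedSnModule quot_comp0 quot_compP quot_span quot_indep
    quot_act_linear quot_act1 quot_actM quot_comp_act.

End IdealQuotient.

(* Elementary symmetric polynomials have an integer degree, so that those of *)
(* negative degree vanish.                                                   *)
Definition elem_sym (n : nat) (m : int) : {mpoly rat[n]} :=
  if m is Posz d then mesym n rat d else 0.

Definition elem_sym_omit (n : nat) (i : 'I_n) (m : int) : {mpoly rat[n]} :=
  if m is Posz d then
    \sum_(h : {set 'I_n} | (#|h| == d) && (i \notin h)) \prod_(j in h) 'X_j
  else 0.

Definition Jn_gens (n : nat) (p : {mpoly rat[n]}) : Prop :=
  exists (i : 'I_n) (d r : nat),
    (1 <= r <= d)%N /\ p = 'X_i ^+ d * elem_sym_omit i (n%:Z - r%:Z).

Definition top_esym (n k : nat) (p : {mpoly rat[n]}) : Prop :=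
  exists2 t : nat, (t < k)%N & p = elem_sym n (n%:Z - t%:Z).

(* The sum of two ideals is generated by the union of their generators.      *)
Definition Jnk_gens (n k : nat) (p : {mpoly rat[n]}) : Prop :=
  Jn_gens p \/ top_esym k p.

Definition I_gens (n j : nat) (p : {mpoly rat[n]}) : Prop :=
  (exists i : 'I_n, p = 'X_i ^+ j) \/ top_esym j p.

Section Generators.
Variable n : nat.
Implicit Types (p : {mpoly rat[n]}) (h : {set 'I_n}).

Lemma prodX_dhomog h : \prod_(j in h) 'X_j \is [in rat[n], #|h|.-homog].
Proof.
rewrite -sum1_card; elim/big_rec2: _ => [|i p d _ hd]; first exact: dhomog1.
by apply: dhomogM => //; rewrite dhomogX /= mdeg1.
Qed.

Lemma elem_sym_dhomog m : exists d, elem_sym n m \is d.-homog.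
Proof.
case: m => d; last by exists 0%N; apply: dhomog0.
by exists d; apply: rpred_sum => h /eqP<-; apply: prodX_dhomog.
Qed.

Lemma elem_sym_omit_dhomog (i : 'I_n) m : exists d, elem_sym_omit i m \is d.-homog.
Proof.
case: m => d; last by exists 0%N; apply: dhomog0.
by exists d; apply: rpred_sum => h /andP[/eqP<- _]; apply: prodX_dhomog.
Qed.

Lemma Xn_dhomog (i : 'I_n) d : 'X_i ^+ d \is [in rat[n], (1 * d).-homog].
Proof. by apply: dhomogMn; rewrite dhomogX /= mdeg1. Qed.

Lemma msym_X w (i : 'I_n) : msym w 'X_i = 'X_(w i) :> {mpoly rat[n]}.
Proof.
rewrite msymX; congr 'X_[_]; apply/mnmP=> j; rewrite !mnmE.
by rewrite (canF_eq (permK w)) eq_sym (canF_eq (permKV w)) eq_sym.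
Qed.

Lemma msym_elem_sym w m : msym w (elem_sym n m) = elem_sym n m.
Proof. by case: m => d; [apply/issymP; apply: mesym_sym | apply: msym0]. Qed.

Lemma msym_elem_sym_omit w (i : 'I_n) m :
  msym w (elem_sym_omit i m) = elem_sym_omit (w i) m.
Proof.
case: m => d /=; last exact: msym0.
rewrite linear_sum /= [RHS](reindex_inj (imset_inj (@perm_inj _ w))) /=.
apply: eq_big => h.
  by rewrite card_imset ?mem_imset //; apply: perm_inj.
move=> _; rewrite rmorph_prod big_imset /=; last by move=> ? ? _ _ /perm_inj.
by apply: eq_bigr => j _; rewrite msym_X.
Qed.

Lemma top_esym_homog k p : top_esym k p -> exists d, p \is d.-homog.
Proof. by move=> [t _ ->]; apply: elem_sym_dhomog. Qed.

Lemma top_esym_stable k (w : 'S_n) p : top_esym k p -> top_esym k (msym w p).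
Proof. by move=> [t tk ->]; exists t; rewrite ?msym_elem_sym. Qed.

Lemma Jnk_gens_homog k p : Jnk_gens k p -> exists d, p \is d.-homog.
Proof.
case=> [[i [d [r [_ ->]]]]|]; last exact: top_esym_homog.
have [e he] := elem_sym_omit_dhomog i (n%:Z - r%:Z).
by exists (1 * d + e)%N; apply: dhomogM => //; apply: Xn_dhomog.
Qed.

Lemma Jnk_gens_stable k (w : 'S_n) p : Jnk_gens k p -> Jnk_gens k (msym w p).
Proof.
case=> [[i [d [r [rd ->]]]]|]; last by right; apply: top_esym_stable.
left; exists (w i), d, r; split=> //.
by rewrite msymM rmorphXn /= msym_X msym_elem_sym_omit.
Qed.

Lemma I_gens_homog j p : I_gens j p -> exists d, p \is d.-homog.
Proof.
case=> [[i ->]|]; last exact: top_esym_homog.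
by exists (1 * j)%N; apply: Xn_dhomog.
Qed.

Lemma I_gens_stable j (w : 'S_n) p : I_gens j p -> I_gens j (msym w p).
Proof.
case=> [[i ->]|]; last by right; apply: top_esym_stable.
by left; exists (w i); rewrite rmorphXn /= msym_X.
Qed.

End Generators.

Definition S_mod (n k : nat) : gradedSnModule n :=
  graded_quot (@Jnk_gens_homog n k) (@Jnk_gens_stable n k).

Definition R_mod (n j : nat) : gradedSnModule n :=
  graded_quot (@I_gens_homog n j) (@I_gens_stable n j).

(* Main.v *)
Require Import Defs.
From HB Require Import structures.
From mathcomp Require Import all_boot all_order all_algebra all_fingroup.
From mathcomp Require Import boolp mpoly ring zify.
Set Implicit Arguments.
Unset Strict Implicit.
Unset Printing Implicit Defensive.
Import GRing.Theory.
Local Open Scope ring_scope.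

(** Write J_k and I_k for the ideals J_{n,k} and I_{n,k}, and P for the
    polynomial ring.  As J_{k+1} = J_k + (e_{n-k}) and e_{n-k} I_k lies in J_k
    ([I_gens_mul_coesym]), multiplication by the symmetric polynomial e_{n-k}
    induces a right exact sequence
    R_k<-n+k> -> S_k -> S_{k+1} -> 0 ending at S_n = R_n.  The theorem says
    that these sequences are exact on the left and split equivariantly.

    Left exactness is the colon property [colon_Jnk]: if e_{n-k} f is in J_k,
    then f is in I_k.  It is a dimension count.  Let N_j be the number of
    surjections from an n-set onto a j-set.

    - dim R_j <= N_j ([codim_I_gens]): filter by the powers of one variable
      x_i.  The graded pieces are quotients of the analogous rings in the
      remaining variables, and the resulting recursion for the dimensions is
      the one that counts surjections by the value at i.
    - Hence dim S_0 <= N_0 + ... + N_n, by the sequences above; and a single f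
      violating the colon property would make this inequality strict, since
      one could replace I_k by I_k + (f) in the count.
    - dim S_0 >= N_0 + ... + N_n ([codim_Jn0_ge], [card_packed]): each
      generator of J_0 is the top-degree component of a polynomial that
      vanishes on the finite set of packed words, those words w in
      {0, ..., n-1}^n whose letters form an initial segment ([Jn_deform]).  So
      homogeneous polynomials spanning P modulo J_0 also span the functions on
      this set, and classifying packed words by their number of letters gives
      N_0 + ... + N_n of them.

    For the splitting, averaging over the symmetric group turns a graded
    linear projection along I_j into an equivariant one, pi_j
    ([equivariant_projection_exists]).  Then
    (f_j)_j |-> sum_j e_{n-j} pi_j(f_j) induces an equivariant graded linear
    map from the direct sum of the R_j<-n+j> to S_k.  It is onto because
    q - pi_j(q) is in I_j ([decompose_mod_Jnk]) and injective by the colon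
    property ([decomposition_unique]). *)

(** * Elementary symmetric polynomials indexed by codegree *)

Lemma prod_XaddC (R : comNzRingType) (I : finType) (T : {set I}) (v : I -> R) :
  \prod_(j in T) ('X + (v j)%:P) =
  \sum_(h : {set I} | h \subset T) (\prod_(j in h) v j) *: 'X^(#|T| - #|h|).
Proof.
pose F j : {poly R} := if j \in T then (v j)%:P else 0.
pose G j : {poly R} := if j \in T then 'X else 1.
transitivity (\prod_j (F j + G j)).
  rewrite big_mkcond; apply: eq_bigr => j _; rewrite /F /G.
  by case: ifP => _; rewrite ?add0r // addrC.
rewrite bigA_distr (bigID (fun h : {set I} => h \subset T)) /=.
rewrite [X in _ + X]big1 ?addr0; last first.
  by move=> h /subsetPn[j jh jT]; rewrite (bigD1 j) //= jh /F (negPf jT) mul0r.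
apply: eq_bigr => h hT.
rewrite (bigID (mem h)) /= (eq_bigr (fun j => (v j)%:P)); last first.
  by move=> j jh; rewrite /F jh (subsetP hT).
rewrite -rmorph_prod -mul_polyC; congr (_ * _).
rewrite (bigID (mem T)) /= [X in _ * X]big1 ?mulr1; last first.
  by move=> j /andP[/negPf-> /negPf jT]; rewrite /G jT.
rewrite (eq_bigr (fun=> 'X)); last first.
  by move=> j /andP[/negPf-> jT]; rewrite /G jT.
rewrite prodr_const; congr (_ ^+ _).
rewrite -(cardsID h T) (setIidPr hT) addKn; apply: eq_card => j.
by rewrite !inE.
Qed.

Section CoElementary.
Variable n : nat.
Local Notation P := {mpoly rat[n]}.
Implicit Types (T : {set 'I_n}) (i : 'I_n).

(** This is the elementary symmetric polynomial of degree #|T| - N in the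
    variables of T.  Counting the degree from the top makes the generators of
    I_{n,k} the [coesym setT t] for t < k, whatever n is, and the Pascal-type
    rules below free of subtraction. *)
Definition coesym T N : P := (\prod_(j in T) ('X + ('X_j)%:P))`_N.

Lemma coesymE T N d : (d + N)%N = #|T| ->
  coesym T N =
  \sum_(h : {set 'I_n} | (#|h| == d) && (h \subset T)) \prod_(j in h) 'X_j.
Proof.
move=> dN; rewrite /coesym prod_XaddC coef_sum big_mkcond [RHS]big_mkcond /=.
apply: eq_bigr => h _; rewrite andbC; case: ifP => //= hT.
rewrite coefZ coefXn -dN; have := subset_leq_card hT; rewrite -dN => hd.
have -> : (N == d + N - #|h|)%N = (#|h| == d) by lia.
by case: ifP; rewrite ?mulr1 ?mulr0.
Qed.

Lemma coesym_out T N : (#|T| < N)%N -> coesym T N = 0.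
Proof.
move=> TN; rewrite /coesym prod_XaddC coef_sum big1 // => h hT.
by rewrite coefZ coefXn gtn_eqF ?mulr0 //; lia.
Qed.

Lemma coesymD1_0 T i : i \in T -> coesym T 0 = 'X_i * coesym (T :\ i) 0.
Proof.
by move=> iT; rewrite /coesym (big_setD1 i) //= mulrDl coefD coefXM coefCM
  add0r.
Qed.

Lemma coesymD1_S T i N : i \in T ->
  coesym T N.+1 = coesym (T :\ i) N + 'X_i * coesym (T :\ i) N.+1.
Proof.
by move=> iT; rewrite /coesym (big_setD1 i) //= mulrDl coefD coefXM coefCM.
Qed.

Lemma coesym_lead T : coesym T #|T| = 1.
Proof.
rewrite (@coesymE T _ 0) ?add0n // (big_pred1 set0) ?big_set0 // => h.
by rewrite cards_eq0 /=; case: eqP => // ->; rewrite sub0set.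
Qed.

Lemma coesym_dhomog T N : coesym T N \is (#|T| - N).-homog.
Proof.
have [NT|/coesym_out->] := leqP N #|T|; last exact: dhomog0.
rewrite (@coesymE T N (#|T| - N)%N) ?subnK //.
by apply: rpred_sum => h /andP[/eqP<- _]; apply: prodX_dhomog.
Qed.

Lemma meval_coesym (v : 'I_n -> rat) T N :
  (coesym T N).@[v] = (\prod_(j in T) ('X + (v j)%:P))`_N.
Proof.
rewrite /coesym -(coef_map (meval v)) rmorph_prod /=.
congr (nth 0 (polyseq _) N).
by apply: eq_bigr => j _; rewrite rmorphD /= map_polyX map_polyC /= mevalXU.
Qed.

Lemma elem_symE t : (t <= n)%N -> elem_sym n (n%:Z - t%:Z) = coesym setT t.
Proof.
move=> tn; rewrite (@coesymE _ t (n - t)) ?cardsT ?card_ord ?subnK //.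
rewrite subzn //=; apply: eq_bigl => h.
by rewrite subsetT andbT.
Qed.

Lemma elem_sym_omitE i r : (0 < r)%N ->
  elem_sym_omit i (n%:Z - r%:Z) = coesym (~: [set i]) r.-1.
Proof.
move=> r0; have cT : #|~: [set i]| = n.-1 by rewrite cardsC1 card_ord.
have n0 : (0 < n)%N by apply: leq_ltn_trans (ltn_ord i).
have [rn|nr] := leqP r n.
  rewrite (@coesymE _ r.-1 (n - r)) ?cT; last lia.
  by rewrite subzn //=; apply: eq_bigl => h;
    rewrite -disjoints_subset disjoint_sym disjoints1.
rewrite coesym_out ?cT; last by lia.
by case E: (n%:Z - r%:Z) => [d|d] //=; lia.
Qed.

Lemma msym_coesymT (w : 'S_n) t : msym w (coesym setT t) = coesym setT t.
Proof.
have [tn|nt] := leqP t n; first by rewrite -elem_symE // msym_elem_sym.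
by rewrite coesym_out ?msym0 ?cardsT ?card_ord.
Qed.

End CoElementary.

(** * Ideals and bounds on the dimension of their quotients *)

Section Codimension.
Variable n : nat.
Local Notation P := {mpoly rat[n]}.
Implicit Types (G H : P -> Prop) (p q g : P).

Lemma mem_ideal_gen G g : G g -> g \in ideal_gen G.
Proof. by move=> Gg; rewrite -[g]mul1r; apply: ideal_genM. Qed.

Lemma ideal_gen_mulr G H c p :
  (forall g, G g -> c * g \in ideal_gen H) ->
  p \in ideal_gen G -> c * p \in ideal_gen H.
Proof.
move=> GH /asboolP[s [sG ->]]; rewrite mulr_sumr big_seq.
by apply: rpred_sum => x /sG/GH xH; rewrite mulrCA; apply: ideal_genMl.
Qed.

Lemma ideal_gen_sub G H p :
  (forall g, G g -> g \in ideal_gen H) ->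
  p \in ideal_gen G -> p \in ideal_gen H.
Proof.
move=> GH pG; rewrite -[p]mul1r; apply: ideal_gen_mulr pG => g Gg.
by rewrite mul1r GH.
Qed.

Lemma ideal_gen_principal_ext G H g p :
  (forall x, H x -> exists q, x - q * g \in ideal_gen G) ->
  p \in ideal_gen H -> exists q, p - q * g \in ideal_gen G.
Proof.
move=> HG /asboolP[s [sH ->]].
elim: s sH => [|x s IHs] sH.
  by exists 0; rewrite big_nil mul0r subr0 ideal_gen0.
have [|q qP] := IHs; first by move=> y ys; apply: sH; rewrite inE ys orbT.
have [r rP] := HG _ (sH x (mem_head _ _)).
exists (x.1 * r + q).
have -> : \sum_(y <- x :: s) y.1 * y.2 - (x.1 * r + q) * g =
  x.1 * (x.2 - r * g) + (\sum_(y <- s) y.1 * y.2 - q * g).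
  by rewrite big_cons; ring.
by apply: ideal_genD => //; apply: ideal_genMl.
Qed.

Definition spans_mod G m (b : 'I_m -> P) : Prop :=
  forall p, exists c : 'I_m -> rat, p - \sum_i c i *: b i \in ideal_gen G.

(** dim P / (G) <= m.  The spanning family is required to be homogeneous: that
    is what makes the graded arguments possible, namely the comparison with
    point evaluations and the construction of a graded projection. *)
Definition codim_le G m : Prop := exists2 b : 'I_m -> P,
  forall i, exists d, b i \is d.-homog & spans_mod G b.

Lemma codim_le_sub G H m :
  (forall g, G g -> g \in ideal_gen H) -> codim_le G m -> codim_le H m.
Proof.
move=> GH [b hb bP]; exists b => // p.
by have [c cP] := bP p; exists c; apply: ideal_gen_sub cP.
Qed.

Lemma codim_le_unit G : 1 \in ideal_gen G -> codim_le G 0.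
Proof.
move=> G1; exists (fun=> 0) => [[]//|p]; exists (fun=> 0).
by rewrite big_ord0 subr0 -[p]mulr1; apply: ideal_genMl.
Qed.

(** Subadditivity of the dimension in a right exact sequence
    P/(G'') -> P/(G) -> P/(G') -> 0 whose first map is multiplication by g. *)
Lemma codim_le_exact G G' G'' g a b :
  (exists d, g \is d.-homog) ->
  (forall x, G'' x -> g * x \in ideal_gen G) ->
  (forall x, G' x -> exists q, x - q * g \in ideal_gen G) ->
  codim_le G' a -> codim_le G'' b -> codim_le G (a + b).
Proof.
move=> [e he] G''G G'G [b' hb' b'P] [b'' hb'' b''P].
exists (fun i => match split i with
    inl j => b' j | inr j => g * b'' j end) => [i|p].
  case: (split i) => j; first exact: hb'.
  by have [d hd] := hb'' j; exists (e + d)%N; apply: dhomogM.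
have [c' c'P] := b'P p.
have [q qP] := ideal_gen_principal_ext G'G c'P.
have [c'' c''P] := b''P q.
exists (fun i => match split i with inl j => c' j | inr j => c'' j end).
rewrite big_split_ord /=.
under eq_bigr => j _ do rewrite -[lshift _ _]/(unsplit (inl j)) unsplitK.
under [X in _ - (_ + X)]eq_bigr => j _ do
  rewrite -[rshift _ _]/(unsplit (inr j)) unsplitK scalerAr.
rewrite -mulr_sumr; set A := \sum_i _; set B := \sum_i _.
have -> : p - (A + g * B) = (p - A - q * g) + g * (q - B) by ring.
by apply: ideal_genD => //; apply: ideal_gen_mulr c''P.
Qed.

(** Exchange: a family member with a nonzero coefficient in some relation can be
    dropped. *)
Lemma spans_mod_lift G m (b : 'I_m.+1 -> P) (c : 'I_m.+1 -> rat) i :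
  spans_mod G b -> \sum_j c j *: b j \in ideal_gen G -> c i != 0 ->
  spans_mod G (fun j => b (lift i j)).
Proof.
move=> bP cG ci p; have [a aP] := bP p.
exists (fun j => a (lift i j) - a i / c i * c (lift i j)).
have -> : p - \sum_j (a (lift i j) - a i / c i * c (lift i j)) *: b (lift i j) =
   (p - \sum_j a j *: b j) + (a i / c i) *: \sum_j c j *: b j.
  rewrite !(bigD1_ord i) //= scalerDr scalerA divfK // scaler_sumr.
  under eq_bigr => j _ do rewrite scalerBl -scalerA.
  rewrite sumrB; ring.
by apply: ideal_genD => //; apply: ideal_genZ.
Qed.

Lemma codim_le_drop G f m : f \notin ideal_gen G -> codim_le G m ->
  exists2 m', m = m'.+1 & codim_le (fun p => G p \/ p = f) m'.
Proof.
move=> fG [b hb bP]; have [c cP] := bP f.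
have [i ci] : exists i, c i != 0.
  apply/existsP; apply: contraR fG; rewrite negb_exists => /forallP c0.
  rewrite -[f]subr0; move: cP; rewrite big1 // => i _.
  by have := c0 i; rewrite negbK => /eqP->; rewrite scale0r.
case: m i b c hb bP cP ci => [[]//|m] i b c hb bP cP ci; exists m => //.
have GI q : q \in ideal_gen G -> q \in ideal_gen (fun p => G p \/ p = f).
  by apply: ideal_gen_sub => g Gg; apply: mem_ideal_gen; left.
exists (fun j => b (lift i j)) => [j|]; first exact: hb.
apply: spans_mod_lift ci => [p|].
  by have [a /GI] := bP p; exists a.
rewrite -[X in X \in _](subKr f); apply: rpredB; last exact: GI.
by apply: mem_ideal_gen; right.
Qed.

Lemma codim_le_basis G m : codim_le G m ->
  exists k (b : 'I_k -> P),
    [/\ forall i, exists d, b i \is d.-homog, spans_mod G b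
    & forall c : 'I_k -> rat, \sum_i c i *: b i \in ideal_gen G ->
      forall i, c i = 0].
Proof.
elim: m => [|m IHm] [b hb bP]; first by exists 0%N, b; split=> // c _ [].
have [[c cG [i /eqP ci]]|ind] := pselect (exists2 c : 'I_m.+1 -> rat,
    \sum_i c i *: b i \in ideal_gen G & exists i, c i <> 0).
  apply: IHm; exists (fun j => b (lift i j)) => [j|]; first exact: hb.
  exact: spans_mod_lift cG ci.
exists m.+1, b; split=> // c cG i; apply: contrapT => ci.
by apply: ind; exists c => //; exists i.
Qed.

End Codimension.

(** * Upper bound for the dimension of R_{n,k} *)

(** The number of maps from an m-set to a k-set whose image contains s given
    values (see [card_onto_words]), computed from the value at one point. *)
Fixpoint onto_count (m k s : nat) : nat :=
  if m is m'.+1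
  then (s * onto_count m' k s.-1 + (k - s) * onto_count m' k s)%N
  else (s == 0%N).

Section UpperBound.
Variable n : nat.
Local Notation P := {mpoly rat[n]}.
Implicit Types (G H : P -> Prop) (p q g : P) (T : {set 'I_n}).

(** Substituting [coesymD1_S] repeatedly, x_i^(t+1) coesym (T - i) t is an
    alternating sum of the x_i^u coesym T u for u <= t. *)
Lemma Xn_coesymD1 G T i t : i \in T ->
  (forall u, (u <= t)%N -> coesym T u \in ideal_gen G) ->
  'X_i ^+ t.+1 * coesym (T :\ i) t \in ideal_gen G.
Proof.
move=> iT; elim: t => [|t IHt] TG.
  by rewrite expr1 -coesymD1_0 // TG.
have -> : 'X_i ^+ t.+2 * coesym (T :\ i) t.+1 =
    'X_i ^+ t.+1 * coesym T t.+1 - 'X_i ^+ t.+1 * coesym (T :\ i) t.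
  by rewrite (coesymD1_S t iT) !exprS; ring.
apply: rpredB; first by apply/ideal_genMl/TG.
by apply: IHt => u ut; apply/TG/leqW.
Qed.

(** For k > 0, the ideal of the ring
    R_{T,k,s} = Q[x_i : i in T] / (x_i^k, e_{#|T|-t} for t < s)
    inside the full polynomial ring, the other variables being killed.  Letting s
    vary independently of k is what makes the induction on T work. *)
Definition partial_gens T k s p : Prop :=
  [\/ exists i, p = 'X_i ^+ k,
      exists2 t, (t < s)%N & p = coesym T t
    | exists2 i, i \notin T & p = 'X_i].

Lemma X_dhomog (i : 'I_n) d : exists e, ('X_i ^+ d : P) \is e.-homog.
Proof. by exists (1 * d)%N; apply: Xn_dhomog. Qed.

(** Filtration of R_{T,k,s} by the powers of x_i: the piece
    x_i^a R / x_i^(a+1) R is a quotient of R_{T-i,k,s-1}, and even of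
    R_{T-i,k,s} when a >= s, because x_i^a e_{#|T|-s}(T - i) is then 0 by
    [Xn_coesymD1].  The s smallest exponents thus play the part of the s values
    that must be hit. *)
Lemma partial_gens_step T k s a i : i \in T ->
  codim_le (fun p => partial_gens T k s p \/ p = 'X_i ^+ a)
    (\sum_(u < a) if (u < s)%N then onto_count #|T :\ i| k s.-1
                  else onto_count #|T :\ i| k s) ->
  codim_le (partial_gens (T :\ i) k (if (a < s)%N then s.-1 else s))
    (if (a < s)%N then onto_count #|T :\ i| k s.-1
     else onto_count #|T :\ i| k s) ->
  codim_le (fun p => partial_gens T k s p \/ p = 'X_i ^+ a.+1)
    (\sum_(u < a.+1) if (u < s)%N then onto_count #|T :\ i| k s.-1
                     else onto_count #|T :\ i| k s).
Proof.
move=> iT ca cT; rewrite big_ord_recr.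
apply: codim_le_exact (X_dhomog i a) _ _ ca cT; last first.
  move=> x [Tx|->].
    by exists 0; rewrite mul0r subr0 mem_ideal_gen //; left.
  by exists 1; rewrite mul1r subrr ideal_gen0.
set G := fun p => _ \/ _.
have GT u : (u < s)%N -> coesym T u \in ideal_gen G.
  by move=> us; apply: mem_ideal_gen; left; apply: Or32; exists u.
have Ga : 'X_i ^+ a.+1 \in ideal_gen G by apply: mem_ideal_gen; right.
move=> x [[j ->]|[t ts ->]|[j jT ->]].
- by apply/ideal_genMl/mem_ideal_gen; left; apply: Or31; exists j.
- have [tas|at_] := ltnP t.+1 (if (a < s)%N then s.-1.+1 else 0%N).
    have -> : 'X_i ^+ a * coesym (T :\ i) t =
      'X_i ^+ a * coesym T t.+1 - coesym (T :\ i) t.+1 * 'X_i ^+ a.+1.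
      by rewrite (coesymD1_S t iT) !exprS; ring.
    apply: rpredB; apply: ideal_genMl => //; apply: GT.
    by move: tas; case: ifP => //; lia.
  have [sa|as_] := ltnP a s.
    by exfalso; move: ts at_; rewrite sa; lia.
  have ts' : (t < s)%N by move: ts; case: ifP; lia.
  have -> : a = (a - t.+1 + t.+1)%N by lia.
  rewrite exprD -mulrA; apply: ideal_genMl; apply: Xn_coesymD1 => // u ut.
  by apply: GT; lia.
- have [->|ji] := eqVneq j i; first by rewrite -exprSr.
  apply/ideal_genMl/mem_ideal_gen; left; apply: Or33; exists j => //.
  by move: jT; rewrite !inE ji.
Qed.

Lemma codim_partial_gens T k s : (s <= k)%N ->
  codim_le (partial_gens T k s) (onto_count #|T| k s).
Proof.
move: {2}#|T| (erefl #|T|) => m; elim: m T s => [|m IHm] T s cT sk.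
  rewrite cT; move/eqP: cT; rewrite cards_eq0 => /eqP->.
  case: s sk => [|s] _ /=; last first.
    apply: codim_le_unit; rewrite -(coesym_lead (set0 : {set 'I_n})) cards0.
    by apply: mem_ideal_gen; apply: Or32; exists 0%N.
  exists (fun=> 1) => [i|p]; first by exists 0%N; apply: dhomog1.
  exists (fun=> p@_0%MM); rewrite big_ord1.
  (* Every monomial other than 1 is in the ideal. *)
  elim/mpolyind: p => [|c m' p _ _ IHp].
    by rewrite mcoeff0 scale0r subr0 ideal_gen0.
  rewrite mcoeffD mcoeffZ mcoeffX scalerDl opprD addrACA.
  apply: ideal_genD => //; case: eqVneq => [->|m0].
    by rewrite mulr1 mpolyX0 subrr ideal_gen0.
  rewrite mulr0 scale0r subr0; apply: ideal_genZ.
  have [i mi] : exists i, m' i != 0%N.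
    apply/existsP; apply: contraR m0; rewrite negb_exists => /forallP m0.
    apply/eqP/mnmP => i; rewrite mnm0E; apply/eqP.
    by have := m0 i; rewrite negbK.
  have -> : m' = ((m' - U_(i)) + U_(i))%MM by rewrite submK // lep1mP.
  rewrite mpolyXD; apply/ideal_genMl/mem_ideal_gen; apply: Or33.
  by exists i; rewrite ?inE.
have [i iT] : exists i, i \in T by apply/set0Pn; rewrite -cards_eq0 cT.
have cTi : #|T :\ i| = m by move: cT; rewrite (cardsD1 i) iT => -[].
have chain a : codim_le (fun p => partial_gens T k s p \/ p = 'X_i ^+ a)
    (\sum_(u < a) if (u < s)%N then onto_count #|T :\ i| k s.-1
                  else onto_count #|T :\ i| k s).
  elim: a => [|a IHa].
    rewrite big_ord0; apply: codim_le_unit.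
    by apply: mem_ideal_gen; right; rewrite expr0.
  apply: partial_gens_step => //.
  by case: ifP => _; apply: IHm => //; lia.
have -> : onto_count #|T| k s = (\sum_(u < k) if (u < s)%N
    then onto_count #|T :\ i| k s.-1 else onto_count #|T :\ i| k s)%N.
  rewrite cT cTi /= -(big_mkord xpredT (fun u => if (u < s)%N
    then onto_count m k s.-1 else onto_count m k s)).
  rewrite (big_cat_nat (n := s)) //=; congr (_ + _)%N.
    rewrite (eq_big_nat _ _ (F2 := fun=> onto_count m k s.-1)).
      by rewrite sum_nat_const_nat subn0.
    by move=> u /andP[_ ->].
  rewrite (eq_big_nat _ _ (F2 := fun=> onto_count m k s)).
    by rewrite sum_nat_const_nat.
  by move=> u /andP[su _]; rewrite ltnNge su.
apply: codim_le_sub (chain k) => g [Tg|->]; apply: mem_ideal_gen => //.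
by apply: Or31; exists i.
Qed.

Lemma codim_I_gens k : (k <= n)%N -> codim_le (@I_gens n k) (onto_count n k k).
Proof.
move=> kn; rewrite -[X in onto_count X](card_ord n) -cardsT.
apply: codim_le_sub (codim_partial_gens setT (leqnn k)).
move=> g [[i ->]|[t tk ->]|[i]].
- by apply: mem_ideal_gen; left; exists i.
- apply: mem_ideal_gen; right; exists t => //.
  by rewrite elem_symE //; lia.
- by rewrite inE.
Qed.

End UpperBound.

(** * The sequences R_{n,k} -> S_{n,k} -> S_{n,k+1} *)

Section Multiplication.
Variables n k : nat.
Local Notation P := {mpoly rat[n]}.
Implicit Types (p q g : P).

Lemma Jnk_Xn (i : 'I_n) d r : (r < d)%N ->
  'X_i ^+ d * coesym (~: [set i]) r \in ideal_gen (@Jnk_gens n k).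
Proof.
move=> rd; apply: mem_ideal_gen; left; exists i, d, r.+1.
by rewrite elem_sym_omitE.
Qed.

Lemma Jnk_top t : (t < k <= n)%N -> coesym setT t \in ideal_gen (@Jnk_gens n k).
Proof.
move=> /andP[tk kn]; apply: mem_ideal_gen; right; exists t => //.
by rewrite elem_symE //; lia.
Qed.

(** x_i^k e_{n-k} = x_i^k e_{n-k}^{(i)} + x_i^(k+1) e_{n-k-1}^{(i)}, and both
    terms are among the generators of J_n (for k = 0 the first one vanishes). *)
Lemma I_gens_mul_coesym g : (k <= n)%N -> I_gens k g ->
  coesym setT k * g \in ideal_gen (@Jnk_gens n k).
Proof.
move=> kn [[i ->]|[t tk ->]]; last first.
  by rewrite elem_symE ?ideal_genMl ?Jnk_top ?tk //; lia.
rewrite mulrC; have iT := in_setT i.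
have J d r : (r < d)%N ->
    'X_i ^+ d * coesym (setT :\ i) r \in ideal_gen (@Jnk_gens n k).
  by rewrite setTD; apply: Jnk_Xn.
case El: {1 2}k => [|l].
  by rewrite (coesymD1_0 iT) mulrA -exprSr; apply: J.
rewrite (coesymD1_S l iT) mulrDr mulrA -exprSr.
by apply: ideal_genD; apply: J.
Qed.

End Multiplication.

Lemma Jnk_gens_S n k g : (k < n)%N -> Jnk_gens k.+1 g ->
  exists q : {mpoly rat[n]},
    g - q * coesym setT k \in ideal_gen (@Jnk_gens n k).
Proof.
move=> kn [Jg|[t tk ->]].
  by exists 0; rewrite mul0r subr0; apply: mem_ideal_gen; left.
have [->|ne] := eqVneq t k.
  by exists 1; rewrite mul1r elem_symE ?subrr ?ideal_gen0 //; lia.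
by exists 0; rewrite mul0r subr0 elem_symE ?Jnk_top //; lia.
Qed.

(** e_0^{(i)} = 1, so x_i^n is a generator of J_n. *)
Lemma I_gens_Jnn n g : I_gens n g -> g \in ideal_gen (@Jnk_gens n n).
Proof.
move=> [[i ->]|top]; last by apply: mem_ideal_gen; right.
have n0 : (0 < n)%N by apply: leq_ltn_trans (ltn_ord i).
have := @Jnk_Xn n n i n #|~: [set i]|.
by rewrite coesym_lead mulr1 cardsC1 card_ord; apply; rewrite prednK.
Qed.

Lemma Jnn_I_gens n g : Jnk_gens n g -> g \in ideal_gen (@I_gens n n).
Proof.
move=> [[i [d [r [rd ->]]]]|top]; last by apply: mem_ideal_gen; right.
rewrite elem_sym_omitE; last lia.
have [rn|nr] := leqP r n; last first.
  have n0 : (0 < n)%N by apply: leq_ltn_trans (ltn_ord i).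
  by rewrite coesym_out ?mulr0 ?ideal_gen0 // cardsC1 card_ord; lia.
have -> : d = (d - r + r.-1.+1)%N by lia.
rewrite exprD -mulrA -setTD.
apply/ideal_genMl/Xn_coesymD1; rewrite ?inE // => u ur.
by apply: mem_ideal_gen; right; exists u; rewrite ?elem_symE //; lia.
Qed.

Lemma codim_Jnk_S n k a b : (k < n)%N ->
  codim_le (@Jnk_gens n k.+1) a -> codim_le (@I_gens n k) b ->
  codim_le (@Jnk_gens n k) (a + b).
Proof.
move=> kn; apply: (@codim_le_exact _ _ _ _ (coesym setT k)).
- by eexists; apply: coesym_dhomog.
- by move=> g; apply: I_gens_mul_coesym; lia.
- by move=> g; apply: Jnk_gens_S.
Qed.

Lemma codim_Jnk n k : (k <= n)%N ->
  codim_le (@Jnk_gens n k) (\sum_(k <= j < n.+1) onto_count n j j).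
Proof.
move=> kn; have -> : k = (n - (n - k))%N by lia.
elim: (n - k)%N (leq_subr k n) => [|l IHl] ln.
  rewrite subn0 big_nat1.
  by apply: codim_le_sub (codim_I_gens (leqnn n)) => g; apply: I_gens_Jnn.
rewrite big_ltn ?ltnS ?leq_subr // addnC.
have E : (n - l.+1).+1 = (n - l)%N by lia.
rewrite E; apply: codim_Jnk_S; [lia| |apply: codim_I_gens; lia].
by rewrite E; apply: IHl; lia.
Qed.

Lemma codim_Jn0 n k m : (k <= n)%N -> codim_le (@Jnk_gens n k) m ->
  codim_le (@Jnk_gens n 0) (m + \sum_(0 <= j < k) onto_count n j j).
Proof.
elim: k m => [|k IHk] m kn Jm; first by rewrite big_nil addn0.
rewrite big_nat_recr //= [(\sum_(_ <= _ < _) _ + _)%N]addnC addnA.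
by apply: IHk; [lia | apply: codim_Jnk_S => //; apply: codim_I_gens; lia].
Qed.

(** * Counting packed words *)

Section Words.
Variable A : finType.
Implicit Types (K S : {set A}).

Lemma card_tuple_cons m (Q : pred (m.+1.-tuple A)) :
  #|Q| = (\sum_a #|[pred w : m.-tuple A | Q [tuple of a :: w]]|)%N.
Proof.
rewrite -sum1_card; under [RHS]eq_bigr => a _ do rewrite -sum1_card.
rewrite pair_big_dep /=.
rewrite (reindex (fun x : A * m.-tuple A => [tuple of x.1 :: x.2])) //=.
exists (fun w => (thead w, behead_tuple w)) => [[a w] _|w _] /=.
  by rewrite theadE; congr (_, _); apply: val_inj.
by rewrite [RHS]tuple_eta; apply: val_inj.
Qed.

(** Two letter sets are kept apart, the allowed one K and the required one S,
    because removing a first letter shrinks S but not K. *)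
Definition onto_words m K S : pred (m.-tuple A) :=
  [pred w : m.-tuple A |
    all (fun a => a \in K) w & [forall l in S, l \in val w]].

Arguments onto_words : clear implicits.

Lemma card_onto_words m K S : S \subset K ->
  #|onto_words m K S| = onto_count m #|K| #|S|.
Proof.
elim: m S => [|m IHm] S SK.
  rewrite /= -(eq_card (A := fun w : 0.-tuple A => S == set0)); last first.
    move=> w; rewrite [w]tuple0 /= !inE /=.
    apply/eqP/forallP => [-> a|S0]; first by rewrite inE.
    by apply/setP => a; rewrite inE; have := S0 a; rewrite implybF => /negPf.
  rewrite -cards_eq0; case: eqP => _; last by rewrite eq_card0.
  by rewrite (eq_card (B := predT)) // card_tuple.
rewrite card_tuple_cons.
have step a : #|[pred w : m.-tuple A | onto_words m.+1 K S [tuple of a :: w]]| =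
    if a \in K then onto_count m #|K| #|S :\ a| else 0%N.
  case: ifPn => aK; last first.
    rewrite eq_card0 // => w; by rewrite !inE /onto_words /= (negPf aK).
  rewrite -IHm; last by apply: subset_trans SK; apply: subsetDl.
  apply: eq_card => w; rewrite !inE /onto_words /= aK /=; congr (_ && _).
  by apply: eq_forallb => l; rewrite !inE; case: eqVneq => //=; rewrite implybT.
under eq_bigr do rewrite step.
rewrite -big_mkcond (bigID (fun a => a \in S)) /=; congr (_ + _)%N.
  rewrite (eq_bigl (fun a => a \in S)); last first.
    by move=> a; case aS: (a \in S); rewrite ?andbF // andbT (subsetP SK).
  rewrite (eq_bigr (fun=> onto_count m #|K| #|S|.-1)) ?sum_nat_const //.
  by move=> a aS; rewrite (cardsD1 a S) aS.
rewrite (eq_bigr (fun=> onto_count m #|K| #|S|)).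
  rewrite sum_nat_const; congr (_ * _)%N.
  rewrite -(cardsID S K) (setIidPr SK) addKn; apply: eq_card => a.
  by rewrite !inE andbC.
by move=> a /andP[_ aS]; rewrite (cardsD1 a S) (negPf aS).
Qed.

End Words.

Arguments onto_words [A] m K S.

(** These words encode the ordered set partitions of the positions: the letter l
    marks the members of the l-th block. *)
Definition packed n : pred (n.-tuple 'I_n) :=
  [pred w : n.-tuple 'I_n |
    [forall i, forall l : 'I_n, (l < tnth w i)%N ==> (l \in val w)]].

Lemma card_packed n : (\sum_(j < n.+1) onto_count n j j <= #|@packed n|)%N.
Proof.
pose K j := [set l : 'I_n | (l < j)%N].
have cK (j : 'I_n.+1) : #|K j| = j.
  have jn : (j <= n)%N by rewrite -ltnS.
  have inj : injective (widen_ord jn) by move=> x y [] /val_inj.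
  rewrite -[RHS]card_ord -(card_imset _ inj).
  apply: eq_card => l; rewrite !inE.
  apply/idP/imsetP => [lj|[x _ ->]]; last exact: (ltn_ord x).
  by exists (Ordinal lj) => //; apply: val_inj.
pose f (w : n.-tuple 'I_n) : 'I_n.+1 := inord #|[set l in val w]|.
rewrite -sum1_card (partition_big f xpredT) //=.
apply: leq_sum => j _; rewrite -{1}(cK j) -{2}(cK j) -card_onto_words //.
rewrite sum1dep_card; apply/subset_leq_card/subsetP => w wK; rewrite !inE.
move: wK; rewrite !inE => /andP[/allP wK /forallP Kw].
have wE : [set l in val w] = K j.
  apply/setP => l; rewrite !inE.
  apply/idP/idP => [/wK|lj]; first by rewrite inE.
  by have := Kw l; rewrite inE lj.
rewrite /f wE cK inord_val eqxx andbT; apply/forallP => i.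
apply/forallP => l; apply/implyP => li.
have /wK := mem_tnth i w; rewrite inE => ij.
by have := Kw l; rewrite inE (ltn_trans li ij).
Qed.

(** * Deforming the generators of J_n *)

Section Degree.
Variable n : nat.
Local Notation P := {mpoly rat[n]}.
Implicit Types (p q : P).

Lemma msize_dhomog d p : p \is d.-homog -> (msize p <= d.+1)%N.
Proof.
move=> /dhomogP hp; rewrite msizeE; apply/bigmax_leqP_seq => m mp _.
by rewrite -[mdeg m]/(mdeg m) (hp _ mp).
Qed.

Lemma msizeM_bound a b p q :
  (msize p <= a)%N -> (msize q <= b.+1)%N -> (msize (p * q) <= a + b)%N.
Proof.
move=> pa qb; have [->|p0] := eqVneq p 0; first by rewrite mul0r msize0.
have [->|q0] := eqVneq q 0; first by rewrite mulr0 msize0.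
by rewrite msizeM // -subn1 leq_subLR add1n -addnS leq_add.
Qed.

(** For a homogeneous p of degree d: q has p as its top-degree component. *)
Definition same_top d p q := (msize p <= d.+1)%N /\ (msize (p - q) <= d)%N.

Lemma same_topr d p q : same_top d p q -> (msize q <= d.+1)%N.
Proof.
move=> [pd pqd]; have -> : q = p - (p - q) by ring.
by apply: leq_trans (msizeD_le _ _) _; rewrite msizeN geq_max pd leqW.
Qed.

Lemma same_top1 : same_top 0 1 1.
Proof. by split; rewrite ?msize1 // subrr msize0. Qed.

Lemma same_topM d e p q p' q' :
  same_top d p q -> same_top e p' q' -> same_top (d + e) (p * p') (q * q').
Proof.
move=> pq pq'; have qd := same_topr pq; case: pq pq' => [pd dpq] [pe epq].
split; first exact: (msizeM_bound (a := d.+1)).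
have -> : p * p' - q * q' = (p - q) * p' + (p' - q') * q by ring.
apply: leq_trans (msizeD_le _ _) _; rewrite geq_max msizeM_bound //=.
by rewrite addnC msizeM_bound.
Qed.

End Degree.

Section LowerBound.
Variable n : nat.
Local Notation P := {mpoly rat[n]}.
Implicit Types (p q g : P) (w : n.-tuple 'I_n).

Definition point w (i : 'I_n) : rat := (tnth w i)%:R.

(** Reduction modulo F is linear, so a coefficient of the remainder of
    prod_j (X + v_j) modulo F is a fixed linear combination of the elementary
    symmetric polynomials evaluated at v; it is 0 if F divides the product. *)
Lemma meval_coef_modp (v : 'I_n -> rat) (F : {poly rat}) i s :
  F %| \prod_(j in ~: [set i]) ('X + (v j)%:P) ->
  (\sum_(N < n) (('X^N %% F)`_s) *: coesym (~: [set i]) N).@[v] = 0.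
Proof.
set E := \prod_(j in _) _ => FE.
have sE : (size E <= n)%N.
  rewrite /E (eq_bigr (fun j => 'X - (- v j)%:P)); last first.
    by move=> j _; rewrite polyCN opprK.
  rewrite -big_enum size_prod_XsubC -cardE cardsC1 card_ord.
  by rewrite prednK //; apply: leq_ltn_trans (ltn_ord i).
have EE : E = \sum_(N < n) E`_N *: 'X^N.
  rewrite -[LHS]coefK poly_def; apply/polyP=> l.
  rewrite -!poly_def !coef_poly; case: ltnP => lE.
    by rewrite (leq_trans lE).
  by case: ltnP => // _; rewrite nth_default.
have : (E %% F)`_s = 0 by rewrite (eqP FE) coef0.
rewrite {1}EE (big_morph _ (fun x y => modpD F x y) (mod0p F)) coef_sum => E0.
rewrite raddf_sum /= -[RHS]E0; apply: eq_bigr => N _.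
by rewrite mevalZ modpZl coefZ meval_coesym mulrC.
Qed.

(** Let r <= d and r <= n.  The polynomial deforming x_i^d e_{n-r}^{(i)} is
    x_i^(d-r) prod_(l < r) (x_i - l) eps, where eps is the coefficient of
    X^(r-1) in the remainder of prod_(j <> i) (X + x_j) modulo
    F = prod_(l < r) (X + l).  At a packed word, if the i-th letter is < r
    then the middle factor vanishes; otherwise 0, ..., r-1 all occur among the
    other letters, so that F divides prod_(j <> i) (X + x_j) and eps vanishes.
    The top component of eps is e_{n-r}^{(i)}: X^N mod F has no term in X^(r-1)
    when N < r-1, it is X^(r-1) when N = r-1, and the N > r-1 contribute in
    lower degree. *)
Lemma Jn_deform g : Jn_gens g ->
  exists d g', [/\ g \is d.-homog, same_top d g g'
    & forall w, packed w -> g'.@[point w] = 0].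
Proof.
move=> [i [d [r [rd ->]]]]; rewrite elem_sym_omitE; last lia.
have n0 : (0 < n)%N by apply: leq_ltn_trans (ltn_ord i).
have cT : #|~: [set i]| = n.-1 by rewrite cardsC1 card_ord.
have [rn|nr] := leqP r n; last first.
  exists 0%N, 0; rewrite coesym_out ?mulr0 ?cT; last lia.
  by rewrite dhomog0 /same_top subrr msize0; split=> // w _; rewrite meval0.
pose F : {poly rat} := \prod_(l < r) ('X + (l%:R)%:P).
have sF : size F = r.+1.
  rewrite /F (eq_bigr (fun l : 'I_r => 'X - (- (l%:R : rat))%:P)).
    by rewrite size_prod_XsubC /index_enum -enumT size_enum_ord.
  by move=> l _; rewrite polyCN opprK.
pose eps : P := \sum_(N < n) (('X^N %% F)`_r.-1) *: coesym (~: [set i]) N.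
pose lin : P := \prod_(l < r) ('X_i - (l%:R)%:MP).
exists (d + (n - r))%N, ('X_i ^+ (d - r) * lin * eps); split.
- apply: dhomogM; first by rewrite -{2}[d]mul1n; apply: Xn_dhomog.
  have := coesym_dhomog (~: [set i]) r.-1.
  by rewrite cT (_ : n.-1 - r.-1 = n - r)%N //; lia.
- apply: same_topM.
    have -> : 'X_i ^+ d = 'X_i ^+ (d - r) * 'X_i ^+ r :> P.
      by rewrite -exprD subnK //; lia.
    have {1}-> : d = (d - r + r)%N by lia.
    apply: same_topM.
      split; last by rewrite subrr msize0.
      by rewrite -{2}[(d - r)%N]mul1n; apply/msize_dhomog/Xn_dhomog.
    rewrite /lin; elim: (r) => [|l IHl].
      by rewrite big_ord0 expr0; apply: same_top1.
    rewrite big_ord_recr exprSr /= -[l.+1]addn1; apply: same_topM => //.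
    have X1 : (msize ('X_i : P) <= 2)%N by rewrite msizeX mdeg1.
    by split; rewrite // opprB addrC subrK msizeC; case: eqP.
  split.
    by have := msize_dhomog (coesym_dhomog (~: [set i]) r.-1); rewrite cT; lia.
  have r1n : (r.-1 < n)%N by lia.
  rewrite /eps (bigD1 (Ordinal r1n)) //= modp_small; last first.
    by rewrite size_polyXn sF; lia.
  rewrite coefXn eqxx scale1r opprD addNKr msizeN.
  apply: leq_trans (msize_sum _ _ _) _; apply/bigmax_leqP => N NE.
  have [Nr|rN] := ltnP N r.
    rewrite modp_small; last by rewrite size_polyXn sF; lia.
    rewrite coefXn (_ : (_ == _) = false) ?scale0r ?msize0 //.
    by apply: contraNF NE => /eqP rN; apply/eqP/val_inj.
  apply: leq_trans (msizeZ_le _ _) _.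
  have := msize_dhomog (coesym_dhomog (~: [set i]) N); rewrite cT.
  by have := ltn_ord N; lia.
- move=> w wP; rewrite !mevalM; have [ir|ri] := ltnP (tnth w i) r.
    rewrite /lin [(\prod_(_ < _) _).@[_]]rmorph_prod /=.
    rewrite (bigD1 (Ordinal ir)) //=.
    by rewrite mevalB mevalXU mevalC /point subrr mul0r mulr0 mul0r.
  rewrite meval_coef_modp ?mulr0 //.
  rewrite /F (eq_bigr (fun l : 'I_r => 'X - (- (l%:R : rat))%:P)); last first.
    by move=> l _; rewrite polyCN opprK.
  rewrite -(big_map (fun l : 'I_r => - (l%:R : rat)) xpredT
    (fun c => 'X - c%:P)).
  apply: uniq_roots_dvdp; last first.
    rewrite uniq_rootsE map_inj_uniq ?index_enum_uniq // => a b /oppr_inj /eqP.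
    by rewrite Num.Theory.eqr_nat => /eqP/val_inj.
  apply/allP => _ /mapP[l _ ->].
  have ln : (l < n)%N by apply: leq_trans rn.
  have : Ordinal ln \in val w.
    move/forallP: wP => /(_ i)/forallP/(_ (Ordinal ln))/implyP; apply=> /=.
    exact: leq_trans (ltn_ord l) ri.
  move=> /tnthP[j lj]; rewrite rootE horner_prod (bigD1 j) /=; last first.
    rewrite !inE; apply: contraTneq (ltn_ord l) => ji.
    by rewrite -leqNgt -[val l]/(val (Ordinal ln)) lj ji.
  by rewrite hornerD hornerX hornerC /point -lj addNr mul0r.
Qed.

End LowerBound.

(** * Lower bound for the dimension of S_{n,0}, and the colon property *)

Section Interpolation.
Variable n : nat.
Local Notation P := {mpoly rat[n]}.
Implicit Types (p q g : P) (w : n.-tuple 'I_n).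

(** By induction on the degree: a homogeneous p of degree d is, modulo J_n, a
    combination of the b_i of degree d, and the part in J_n can be written
    homogeneously as a sum of multiples q g of degree d.  On packed words g
    agrees with the lower-degree polynomial g - g' given by [Jn_deform], so
    these multiples take the values of polynomials of degree < d. *)
Lemma Jn0_values_span m (b : 'I_m -> P) :
  (forall i, exists d, b i \is d.-homog) ->
  spans_mod (@Jnk_gens n 0) b ->
  forall p, exists c : 'I_m -> rat,
    forall w, packed w -> p.@[point w] = \sum_i c i * (b i).@[point w].
Proof.
move=> hb bP; pose V p := exists c : 'I_m -> rat,
    forall w, packed w -> p.@[point w] = \sum_i c i * (b i).@[point w].
have V0 p : (forall w, packed w -> p.@[point w] = 0) -> V p.
  move=> p0; exists (fun=> 0) => w wP; rewrite p0 // big1 // => i _.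
  by rewrite mul0r.
have VD p q : V p -> V q -> V (p + q).
  move=> [c cP] [e eP]; exists (fun i => c i + e i) => w wP.
  rewrite mevalD cP // eP // -big_split; apply: eq_bigr => i _.
  by rewrite mulrDl.
have VZ a p : V p -> V (a *: p).
  move=> [c cP]; exists (fun i => a * c i) => w wP.
  by rewrite mevalZ cP // mulr_sumr; apply: eq_bigr => i _; rewrite mulrA.
have Vsum (J : eqType) (s : seq J) (F : J -> P) :
    (forall j, j \in s -> V (F j)) -> V (\sum_(j <- s) F j).
  move=> VF; rewrite big_seq; elim/big_ind: _ => //.
  by apply: (V0) => w _; rewrite meval0.
have Vb i : V (b i).
  exists (fun j => (j == i)%:R) => w _; rewrite (bigD1 i) //= eqxx mul1r.
  by rewrite big1 ?addr0 // => j /negPf->; rewrite mul0r.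
have Vdeg d : forall p, (msize p <= d)%N -> V p.
  elim: d => [|d IHd].
    move=> p; rewrite leqn0 msize_poly_eq0 => /eqP->.
    by apply: (V0) => w _; rewrite meval0.
  suff Vhom p : p \is d.-homog -> V p.
    move=> p pd; rewrite [p]mpolyE; apply: (Vsum) => m' m'p; apply: (VZ).
    have := msize_mdeg_lt m'p => m'd.
    have : (mdeg m' <= d)%N by rewrite -ltnS; apply: leq_trans pd.
    rewrite leq_eqVlt => /orP[/eqP md|md].
      by apply: Vhom; rewrite dhomogX /= md.
    by apply: (IHd); rewrite msizeX.
  move=> hp; have [c] := bP p.
  set x := p - _; move=> xJ.
  have -> : p = pihomog mdeg d x + \sum_i c i *: pihomog mdeg d (b i).
    rewrite /x pihomogB pihomog_dE // [pihomog _ _ (\sum_i _)]linear_sum.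
    by under eq_bigr => i _ do rewrite linearZ; rewrite subrK.
  apply: (VD); last first.
    apply: (Vsum) => i _; apply: (VZ); have [e he] := hb i.
    have [<-|ne] := eqVneq e d; first by rewrite pihomog_dE.
    by rewrite (pihomog_ne0 ne he); apply: (V0) => w _; rewrite meval0.
  move: xJ => /asboolP[s [sJ ->]]; rewrite linear_sum /=.
  apply: (Vsum) => y /sJ.
  case: y => y g /= [Jg|[]//].
  rewrite [y]mpolyE mulr_suml linear_sum /=; apply: (Vsum) => m' _.
  rewrite -scalerAl linearZ /=; apply: (VZ).
  have [e [g' [hg [ge gg'] g'0]]] := Jn_deform Jg.
  have hm : 'X_[m'] * g \is (mdeg m' + e).-homog.
    by apply: dhomogM; rewrite ?dhomogX.
  have [md|ne] := eqVneq (mdeg m' + e)%N d; last first.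
    by rewrite (pihomog_ne0 ne hm); apply: (V0) => w _; rewrite meval0.
  rewrite pihomog_dE -?md //.
  have -> : 'X_[m'] * g = (g - g') * 'X_[m'] + 'X_[m'] * g' by ring.
  apply: (VD); last by apply: (V0) => w wP; rewrite mevalM g'0 ?mulr0.
  by apply: (IHd); rewrite -md addnC; apply: msizeM_bound; rewrite ?msizeX.
by move=> p; apply: (Vdeg (msize p)).
Qed.

Definition indicator w : P :=
  \prod_i \prod_(l < n | l != tnth w i) ('X_i - (l%:R)%:MP).

Lemma meval_indicator w w' :
  ((indicator w).@[point w'] == 0) = (w' != w).
Proof.
rewrite /indicator rmorph_prod prodf_seq_eq0; apply/hasP/idP => [[i _ /=]|ww'].
  rewrite rmorph_prod prodf_seq_eq0 => /hasP[l _ /andP[lw]].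
  rewrite /= mevalB mevalXU mevalC subr_eq0 Num.Theory.eqr_nat.
  move=> /eqP/val_inj E.
  by apply: contraNneq lw => ww'; rewrite -E ww'.
have [i iP] : exists i, tnth w' i != tnth w i.
  apply/existsP; apply: contraR ww'; rewrite negb_exists => /forallP E.
  by apply/eqP/eq_from_tnth => i; apply/eqP; have := E i; rewrite negbK.
exists i; rewrite ?mem_index_enum //= rmorph_prod prodf_seq_eq0.
apply/hasP; exists (tnth w' i); rewrite ?mem_index_enum // iP /=.
by rewrite mevalB mevalXU mevalC subrr.
Qed.

Lemma codim_Jn0_ge m : codim_le (@Jnk_gens n 0) m -> (#|@packed n| <= m)%N.
Proof.
move=> [b hb bP]; have span := Jn0_values_span hb bP.
pose z (i : 'I_#|@packed n|) : n.-tuple 'I_n := enum_val i.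
have zP i : packed (z i) by apply: (enum_valP i).
have /choice[c cP] : forall i, exists c : 'I_m -> rat,
    forall w, packed w ->
      (indicator (z i)).@[point w] = \sum_j c j * (b j).@[point w].
  by move=> i; apply: span.
pose A : 'M[rat]_(#|@packed n|, m) :=
  \matrix_(i, j) (c i j / (indicator (z i)).@[point (z i)]).
pose B : 'M[rat]_(m, #|@packed n|) := \matrix_(j, i) (b j).@[point (z i)].
(* The normalized indicators, written in terms of b, give a left inverse of the
   matrix B of values of b, so B has at least as many rows as columns. *)
apply: (@mulmx1_min _ _ _ A B); apply/matrixP => i i'; rewrite !mxE.
under eq_bigr => j _ do rewrite !mxE mulrAC.
rewrite -mulr_suml -cP //; have [<-|ne] := eqVneq i i'.
  by rewrite divff // meval_indicator eqxx.
have /eqP-> : (indicator (z i)).@[point (z i')] == 0.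
  by rewrite meval_indicator; apply: contraNneq ne => /enum_val_inj->.
by rewrite mul0r.
Qed.

End Interpolation.

(** Multiplication by e_{n-k} from R_{n,k} to S_{n,k} is injective: a nonzero
    class f in the kernel would let it factor through the smaller quotient by
    I_{n,k} + (f), and the dimension of S_{n,0} would fall below the number of
    packed words. *)
Lemma colon_Jnk n k (f : {mpoly rat[n]}) : (k < n)%N ->
  coesym setT k * f \in ideal_gen (@Jnk_gens n k) ->
  f \in ideal_gen (@I_gens n k).
Proof.
move=> kn fJ; apply/negPn/negP => fI.
have [m' mE If] := codim_le_drop fI (codim_I_gens (ltnW kn)).
have Jk : codim_le (@Jnk_gens n k)
    (\sum_(k.+1 <= j < n.+1) onto_count n j j + m').
  apply: codim_le_exact (codim_Jnk kn) If.
  - by eexists; apply: coesym_dhomog (setT : {set 'I_n}) k.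
  - by move=> g [Ig|->] //; apply: I_gens_mul_coesym => //; apply: ltnW.
  - by move=> g; apply: Jnk_gens_S.
have := leq_trans (card_packed n) (codim_Jn0_ge (codim_Jn0 (ltnW kn) Jk)).
rewrite -(big_mkord xpredT (fun j => onto_count n j j)).
rewrite (big_cat_nat (n := k)) //=; last by rewrite ltnW // ltnW.
by rewrite (@big_ltn _ _ _ k) ?ltnS ?(ltnW kn) // mE; lia.
Qed.

(** * Equivariant graded projections along an ideal *)

Section EquivariantProjection.
Variables (n : nat) (G : {mpoly rat[n]} -> Prop).
Local Notation P := {mpoly rat[n]}.
Implicit Types (p q g : P).
Hypothesis G_homog : forall g, G g -> exists d, g \is d.-homog.
Hypothesis G_stable : forall w g, G g -> G (msym w g).

Definition graded_projection (pr : P -> P) : Prop :=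
  [/\ linear pr, forall p, p - pr p \in ideal_gen G,
      forall p, p \in ideal_gen G -> pr p = 0
    & forall d p, p \is d.-homog -> pr p \is d.-homog].

(** Take coordinates in a homogeneous basis modulo the ideal; linearity and
    compatibility with the grading both come from uniqueness of coordinates. *)
Lemma graded_projection_exists m :
  codim_le G m -> exists pr, graded_projection pr.
Proof.
move=> /codim_le_basis[l [b [hb bP bfree]]].
have [c cP] := choice bP; have [e eP] := choice hb.
have cE p (a : 'I_l -> rat) : p - \sum_i a i *: b i \in ideal_gen G ->
    forall i, c p i = a i.
  move=> ap i; apply/eqP; rewrite -subr_eq0; apply/eqP.
  apply: (bfree (fun i => c p i - a i)).
  under eq_bigr => j _ do rewrite scalerBl.
  rewrite sumrB; suff -> : \sum_j c p j *: b j - \sum_j a j *: b j =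
    (p - \sum_j a j *: b j) - (p - \sum_j c p j *: b j) by apply: rpredB.
  ring.
exists (fun p => \sum_i c p i *: b i); split=> // [a p q|p pG|d p hp].
- rewrite scaler_sumr -big_split; apply: eq_bigr => i _ /=.
  rewrite scalerA -scalerDl; congr (_ *: _).
  apply: (cE _ (fun i => a * c p i + c q i)).
  under eq_bigr => j _ do rewrite scalerDl -scalerA.
  rewrite big_split /= -scaler_sumr opprD addrACA -scalerBr.
  by apply: ideal_genD => //; apply: ideal_genZ.
- rewrite big1 // => i _; rewrite (cE p (fun=> 0)) ?scale0r // big1 ?subr0 //.
  by move=> j _; rewrite scale0r.
- have cd i : c p i = if e i == d then c p i else 0.
    apply: (cE p (fun i => if e i == d then c p i else 0)).
    have := ideal_gen_pihomog G_homog d (cP p).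
    rewrite pihomogB pihomog_dE // [pihomog _ _ (\sum_i _)]linear_sum.
    suff -> : \sum_j pihomog mdeg d (c p j *: b j) =
      \sum_j (if e j == d then c p j else 0) *: b j by [].
    apply: eq_bigr => j _; rewrite linearZ /=.
    have [<-|ne] := eqVneq (e j) d; first by rewrite pihomog_dE.
    by rewrite scale0r (pihomog_ne0 ne) ?scaler0.
  apply: rpred_sum => i _; rewrite cd.
  case: eqP => [<-|_]; first exact: dhomogZ.
  by rewrite scale0r dhomog0.
Qed.

(** Maschke averaging: the ideal being stable, every conjugate of a graded
    projection along it is another one, and so is their mean. *)
Lemma equivariant_projection_exists m : codim_le G m ->
  exists2 pr, graded_projection pr
    & forall w p, pr (msym w p) = msym w (pr p).
Proof.
move=> /graded_projection_exists[pr [lin prI pr0 prd]].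
pose av p := (#|'S_n|%:R : rat)^-1 *: \sum_(w : 'S_n) msym w^-1 (pr (msym w p)).
have card0 : (#|'S_n|%:R : rat) != 0.
  by rewrite Num.Theory.pnatr_eq0 -lt0n; apply/card_gt0P; exists 1%g.
have cardK p : p = (#|'S_n|%:R : rat)^-1 *: \sum_(w : 'S_n) p.
  by rewrite sumr_const -scaler_nat scalerA mulVf ?scale1r.
exists av; first split=> [a p q|p|p pG|d p hp].
- rewrite /av scalerA mulrC -scalerA -scalerDr; congr (_ *: _).
  rewrite scaler_sumr -big_split; apply: eq_bigr => w _ /=.
  by rewrite msymD msymZ lin msymD msymZ.
- rewrite {1}[p]cardK /av -scalerBr -sumrB; apply/ideal_genZ/rpred_sum => w _.
  rewrite -{1}[p]msym1m -(mulgV w) msymMm -msymB.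
  exact: (ideal_gen_msym G_stable).
- rewrite /av big1 ?scaler0 // => w _.
  by rewrite pr0 ?msym0 //; apply: (ideal_gen_msym G_stable).
- by apply/dhomogZ/rpred_sum => w _; apply/msym_dhomog/prd/msym_dhomog.
- move=> w p; rewrite /av msymZ; congr (_ *: _).
  rewrite linear_sum /= [RHS](reindex_inj (mulgI w)); apply: eq_bigr => v _ /=.
  by rewrite invMg !msymMm -[in RHS]msymMm mulVg msym1m.
Qed.

End EquivariantProjection.

(** * Isomorphism criterion for graded modules *)

Section GradedIso.
Variables (n : nat) (M N : gradedSnModule n) (f : N -> M).
Hypothesis f_linear : linear f.
Hypothesis f_inj : forall x, f x = 0 -> x = 0.
Hypothesis f_surj : forall y, exists x, f x = y.
Hypothesis f_act : forall w x, f (gract w x) = gract w (f x).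
Hypothesis f_comp : forall d x, grcomp d x -> grcomp d (f x).

Lemma graded_map_sum (J : Type) (s : seq J) (F : J -> N) :
  f (\sum_(j <- s) F j) = \sum_(j <- s) f (F j).
Proof.
have f0 : f 0 = 0.
  by have := f_linear 1 0 0; rewrite !scale1r addr0 -[LHS]addr0 => /addrI <-.
have fD x y : f (x + y) = f x + f y.
  by have := f_linear 1 x y; rewrite !scale1r.
by elim: s => [|j s IHs]; rewrite ?big_nil // !big_cons fD IHs.
Qed.

(** A component of x in a degree other than d has an image that is 0, by
    independence of the components of f x, hence is 0 itself. *)
Lemma graded_reflect d x : grcomp d (f x) -> grcomp d x.
Proof.
move=> fxd; have [s [h [us hP xE]]] := grcomp_span x.
pose k e := (if e \in s then f (h e) else 0) - (if e == d then f x else 0).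
have kP e : grcomp e (k e).
  rewrite /k addrC -scaleN1r; apply: grcompP.
    by case: eqP => [->|_] //; apply: grcomp0.
  by case: ifP => _; [apply: f_comp | apply: grcomp0].
pose t := undup (d :: s).
have k0 : \sum_(e <- t) k e = 0.
  rewrite /k sumrB -!big_mkcond /= -big_filter.
  have dt : d \in t by rewrite mem_undup mem_head.
  rewrite (perm_big s); last first.
    apply: uniq_perm; rewrite ?filter_uniq ?undup_uniq // => e.
    rewrite mem_filter mem_undup inE.
    by case: (e \in s); rewrite ?orbT ?andbF.
  rewrite -graded_map_sum -xE -[X in _ - X]big_filter.
  by rewrite filter_pred1_uniq ?undup_uniq // big_seq1 subrr.
have h0 e : e \in s -> e != d -> h e = 0.
  move=> es ed; have := grcomp_indep (undup_uniq _) kP k0 (d := e).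
  rewrite mem_undup inE es orbT /k es (negPf ed) subr0.
  by move=> /(_ isT)/f_inj.
rewrite xE big_seq; elim/big_ind: _ => [|y z hy hz|e es].
- exact: grcomp0.
- by rewrite -[y]scale1r; apply: grcompP.
- by have [<-|ed] := eqVneq e d; [apply: hP | rewrite h0 //; apply: grcomp0].
Qed.

Lemma graded_iso_inverse : graded_iso M N.
Proof.
have [g gK] := choice f_surj.
have fK x : g (f x) = x.
  apply/eqP; rewrite eq_sym -subr_eq0; apply/eqP/f_inj.
  by have := f_linear (-1) (g (f x)) x; rewrite gK !scaleN1r addNr addrC.
have glin : linear g.
  by move=> a x y; rewrite -[RHS]fK f_linear !gK.
pose L : {linear M -> N} :=
  HB.pack g (GRing.isLinear.Build rat M N *:%R g glin).
exists L; split.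
- by exists f.
- by move=> w x; rewrite /= -{1}(gK x) -f_act fK.
- move=> d x; rewrite -{2}(gK x) /=; split=> [/f_comp//|].
  exact: graded_reflect.
Qed.

End GradedIso.

(** * Splitting S_{n,k} *)

Section Assembly.
Variable n : nat.
Local Notation P := {mpoly rat[n]}.
Local Notation J k := (ideal_gen (@Jnk_gens n k)).
Variable pr : nat -> P -> P.
Hypothesis prP : forall j, (j <= n)%N -> graded_projection (@I_gens n j) (pr j).

Definition esym_term (f : nat -> P) i : P :=
  coesym setT (n - i) * pr (n - i) (f i).

Lemma Jnk_mono k l p : (k <= l)%N -> p \in J k -> p \in J l.
Proof.
move=> kl; apply: ideal_gen_sub => g [Jg|[t tk ->]]; apply: mem_ideal_gen.
  by left.
by right; exists t => //; apply: leq_trans kl.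
Qed.

(** Surjectivity of the map from the direct sum: p - pr_n p is in I_{n,n}, hence
    in J_{n,n}, and whatever is in J_{n,n-r} is in J_{n,n-r-1} up to a multiple
    of the next elementary symmetric polynomial, whose cofactor can be projected in turn. *)
Lemma decompose_mod_Jnk r : (r <= n)%N ->
  forall p, exists f : nat -> P,
    p - \sum_(i < r.+1) esym_term f i \in J (n - r).
Proof.
elim: r => [|r IHr] rn p.
  have [_ prI _ _] := prP (leqnn n).
  exists (fun=> p); rewrite big_ord1 subn0 /esym_term subn0.
  rewrite -{1}[n in coesym _ n]card_ord -cardsT coesym_lead mul1r.
  by apply: ideal_gen_sub (prI p) => g; apply: I_gens_Jnn.
have [f] := IHr (ltnW rn) p; set x := p - _ => xJ.
have nr : (n - r = (n - r.+1).+1)%N by lia.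
have kn : (n - r.+1 < n)%N by lia.
have [q qP] : exists q, x - q * coesym setT (n - r.+1) \in J (n - r.+1).
  apply: ideal_gen_principal_ext xJ => g; rewrite nr.
  exact: Jnk_gens_S.
have [_ prI _ _] := prP (ltnW kn).
exists (fun i => if i == r.+1 then q else f i).
rewrite big_ord_recr /= /esym_term eqxx.
have -> : \sum_(i < r.+1) coesym setT (n - i) *
    pr (n - i) (if i == r.+1 :> nat then q else f i) = p - x.
  rewrite /x subKr; apply: eq_bigr => i _.
  by rewrite ltn_eqF.
set c := coesym _ _; have -> : p - (p - x + c * pr (n - r.+1) q) =
  x - q * c + c * (q - pr (n - r.+1) q) by ring.
apply: ideal_genD => //; apply: ideal_gen_mulr (prI q) => g.
by apply: I_gens_mul_coesym; apply: ltnW.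
Qed.

(** Injectivity: the last term is in the ideal of the previous stage, so by
    induction all other terms vanish, and the colon property applies to it. *)
Lemma decomposition_unique r f : (r <= n)%N ->
  \sum_(i < r.+1) esym_term f i \in J (n - r) ->
  forall i, (i <= r)%N -> pr (n - i) (f i) = 0.
Proof.
elim: r => [|r IHr] rn.
  have [_ prI pr0 _] := prP (leqnn n).
  rewrite big_ord1 subn0 /esym_term subn0.
  rewrite -{1}[n in coesym _ n]card_ord -cardsT coesym_lead mul1r => fJ i.
  rewrite leqn0 => /eqP->; rewrite subn0; apply: pr0.
  rewrite -[f 0%N](subrK (pr n (f 0%N))); apply: ideal_genD; first exact: prI.
  by apply: ideal_gen_sub fJ => g; apply: Jnn_I_gens.
have nr : (n - r = (n - r.+1).+1)%N by lia.
have kn : (n - r.+1 < n)%N by lia.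
rewrite big_ord_recr /= => fJ.
have prf i : (i <= r)%N -> pr (n - i) (f i) = 0.
  apply: IHr (ltnW rn) _ i.
  rewrite -[X in X \in _](addrK (esym_term f r.+1)); apply: rpredB.
    by apply: Jnk_mono fJ; lia.
  by rewrite /esym_term mulrC; apply/ideal_genMl/Jnk_top; lia.
move=> i; rewrite leq_eqVlt => /orP[/eqP->|]; last exact: prf.
have [_ prI pr0 _] := prP (ltnW kn); apply: pr0.
rewrite -[f _](subrK (pr (n - r.+1) (f r.+1))).
apply: ideal_genD; first exact: prI.
apply: colon_Jnk => //; move: fJ; rewrite big1 ?add0r // => j _.
by rewrite /esym_term prf ?mulr0 // -ltnS.
Qed.

End Assembly.

Section Sum.
Variables (n k : nat).
Hypothesis kn : (k <= n)%N.
Local Notation P := {mpoly rat[n]}.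
Variable pr : nat -> P -> P.
Hypothesis prP : forall j, (j <= n)%N -> graded_projection (@I_gens n j) (pr j).
Hypothesis pr_sym : forall j w p, (j <= n)%N ->
  pr j (msym w p) = msym w (pr j p).

Local Notation N :=
  (gdsum (fun i : 'I_(n - k).+1 => gshift (R_mod n (n - i)) (- (i%:Z)))).

Definition lift_class j (x : R_mod n j) : P :=
  pr j (generic_quotient.repr (x : {ideal_quot (ideal_gen (@I_gens n j))})).

Lemma lift_class_pi j p : (j <= n)%N ->
  @lift_class j (mpoly_pi (@I_gens n j) p) = pr j p.
Proof.
move=> jn; have [lin _ pr0 _] := prP jn.
apply/eqP; rewrite -subr_eq0; apply/eqP.
rewrite addrC -scaleN1r -lin; apply: pr0; rewrite scaleN1r addrC.
exact: mpoly_pi_repr.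
Qed.

Definition sum_map (x : N) : S_mod n k :=
  mpoly_pi (@Jnk_gens n k)
    (\sum_(i < (n - k).+1) coesym setT (n - i) * lift_class (x i)).

Lemma sum_map_linear : linear sum_map.
Proof.
move=> a x y; rewrite /sum_map -mpoly_piZ -mpoly_piD scaler_sumr -big_split.
congr (mpoly_pi _ _); apply: eq_bigr => i _ /=.
have jn : (n - i <= n)%N by apply: leq_subr.
have -> : (a *: x + y) i = a *: (x i : R_mod n (n - i)) + y i by [].
have [p ->] := mpoly_pi_surj (x i); have [q ->] := mpoly_pi_surj (y i).
rewrite -mpoly_piZ -mpoly_piD !lift_class_pi //.
by have [-> _ _ _] := prP jn; rewrite mulrDr scalerAr.
Qed.

Lemma sum_map_inj x : sum_map x = 0 -> x = 0.
Proof.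
have /choice[p pP] : forall i : 'I_(n - k).+1,
    exists p, (x i : R_mod n (n - i)) = mpoly_pi _ p.
  by move=> i; apply: mpoly_pi_surj.
rewrite /sum_map -mpoly_pi0 => /mpoly_pi_eq; rewrite subr0 => xJ.
apply: functional_extensionality_dep => i.
have prE := @decomposition_unique n pr prP (n - k)
  (fun i => p (inord i)) (leq_subr _ _).
have pi0 : pr (n - i) (p i) = 0.
  have := prE _ i; rewrite inord_val -ltnS ltn_ord; apply => //.
  rewrite subKn // (_ : \sum_(j < _) _ =
    \sum_(j < (n - k).+1) coesym setT (n - j) * lift_class (x j)) //.
  apply: eq_bigr => j _.
  by rewrite pP lift_class_pi ?leq_subr // /esym_term inord_val.
have -> : (0 : N) i = (0 : R_mod n (n - i)) by [].
rewrite pP -mpoly_pi0; apply/mpoly_pi_eq; rewrite subr0.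
have [_ prI _ _] := prP (leq_subr i n).
by have := prI (p i); rewrite pi0 subr0.
Qed.

Lemma sum_map_surj y : exists x, sum_map x = y.
Proof.
have [p ->] := mpoly_pi_surj y.
have [f] := decompose_mod_Jnk prP (leq_subr k n) p.
rewrite subKn // => fJ.
exists (fun i : 'I_(n - k).+1 =>
  mpoly_pi (@I_gens n (n - i)) (f i) : R_mod n (n - i)).
apply/esym/mpoly_pi_eq; rewrite (_ : \sum_(i < _) _ =
  \sum_(i < (n - k).+1) esym_term pr f i) //.
by apply: eq_bigr => i _; rewrite lift_class_pi ?leq_subr.
Qed.

Lemma sum_map_act w x : sum_map (gract w x) = gract w (sum_map x).
Proof.
rewrite /= /sum_map quot_actE; last by move=> v g; apply: Jnk_gens_stable.
congr (mpoly_pi _ _); rewrite linear_sum; apply: eq_bigr => i _ /=.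
have [p E] := mpoly_pi_surj (x i); rewrite E quot_actE; last first.
  by move=> v g; apply: I_gens_stable.
by rewrite msymM msym_coesymT !lift_class_pi ?leq_subr // pr_sym ?leq_subr.
Qed.

Lemma sum_map_comp d x : grcomp d x -> grcomp d (sum_map x).
Proof.
move=> xd; rewrite /sum_map mpoly_pi_sum; elim/big_ind: _ => [|y z hy hz|i _].
- exact: grcomp0.
- by rewrite -[y]scale1r; apply: grcompP.
have jn : (n - i <= n)%N by apply: leq_subr.
have [_ _ pr0 prd] := prP jn.
have := xd i; rewrite /= /quot_comp; case E: (d - i%:Z) => [e|e]; last first.
  move=> ->; rewrite -mpoly_pi0 lift_class_pi // pr0 ?ideal_gen0 // mulr0.
  rewrite mpoly_pi0.
  exact: (grcomp0 (S_mod n k)).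
move=> [p hp ->]; rewrite lift_class_pi //.
have -> : d = (i + e)%N by lia.
rewrite /=; eexists; last by [].
apply: dhomogM; last exact: prd.
have := coesym_dhomog (setT : {set 'I_n}) (n - i).
rewrite cardsT card_ord subKn //.
by have := ltn_ord i; lia.
Qed.

End Sum.

Theorem theorem4p5 (n k : nat) (hkn : (1 <= k <= n)%N) :
  graded_iso (S_mod n k)
    (gdsum (fun i : 'I_(n - k).+1 => gshift (R_mod n (n - i)) (- (i%:Z)))).
Proof.
have kn : (k <= n)%N by case/andP: hkn.
have /choice[pr prP] : forall j, exists pr : {mpoly rat[n]} -> {mpoly rat[n]},
    (j <= n)%N -> graded_projection (@I_gens n j) pr /\
      forall w p, pr (msym w p) = msym w (pr p).
  move=> j; have [jn|nj] := leqP j n; last by exists id; lia.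
  have [pr prP prw] := equivariant_projection_exists
    (@I_gens_homog n j) (@I_gens_stable n j) (codim_I_gens jn).
  by exists pr.
have prP1 j jn := (prP j jn).1.
have prP2 j w p jn := (prP j jn).2 w p.
apply: (@graded_iso_inverse n _ _ (@sum_map n k pr)).
- exact: sum_map_linear.
- exact: sum_map_inj.
- exact: sum_map_surj.
- exact: sum_map_act.
- exact: sum_map_comp.
Qed.
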